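(* The multivariable Hahn polynomials $H_p(n;y;\gamma;N)$ satisfy, for $j=1,2,\dots,p$, the spectral equations $$\tilde{\mathfrak L}^y_j\,H_p(n;y;\gamma;N)=\tilde\mu_j(n)\,H_p(n;y;\gamma;N),$$ $$\tilde{\mathfrak L}^n_j\,H_p(n;y;\gamma;N)=\tilde\kappa_j(y)\,H_p(n;y;\gamma;N),$$ where $$\tilde\mu_j(n)=-(n_1+\cdots+n_j)(n_1+\cdots+n_j+j+\gamma_1+\cdots+\gamma_{j+1}),\qquad \tilde\kappa_j(y)=N-y_1-y_2-\cdots-y_{p+1-j},$$ and $\tilde{\mathfrak L}^y_j$ (a difference operator in $y$) and $\tilde{\mathfrak L}^n_j$ (a difference operator in $n$) are the operators defined in the context.
   Context: Notation: $p\ge1$, $y=(y_1,\dots,y_p)$, parameters $\gamma=(\gamma_1,\dots,\gamma_{p+1})$ and $N$ real, $y_{p+1}=N-|y|$, $Y_1^k=y_1+\cdots+y_k$ (so $Y_1^{p+1}=N$), $\gamma_1^k=\gamma_1+\cdots+\gamma_k$, $|n|=n_1+\cdots+n_p$, $N_1^k=n_1+\cdots+n_k$, $N_1^0=0$, $(a)_k=a(a+1)\cdots(a+k-1)$. Hahn polynomials: with $h_n(x;a;b;N)=(a+1)_n(-N)_n\,{}_3F_2\!\left[\begin{matrix}-n,\ n+a+b+1,\ -x\\ a+1,\ -N\end{matrix};1\right]$ (denominators of the terminating series cancelled against the prefactor), $$H_p(n;y;\gamma;N)=\frac{(-1)^{|n|}}{(-N)_{|n|}\prod_{k=1}^p(\gamma_{k+1}+1)_{n_k}}\prod_{k=1}^p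 h_{n_k}\big(Y_1^k-N_1^{k-1};\,2N_1^{k-1}+\gamma_1^k+k-1;\,\gamma_{k+1};\,Y_1^{k+1}-N_1^{k-1}\big).$$ Operators in $y$: with $E_{y_l}$ the shift $y_l\mapsto y_l+1$ for $l\le p$ and $E_{y_{p+1}}$ the identity, $$\tilde{\mathfrak L}^y_j=\sum_{1\le l\ne m\le j+1}(y_l+\gamma_l+1)\,y_m\,(E_{y_l}E_{y_m}^{-1}-1).$$ Operators in $n$: First, for $q\ge1$ define $\mathcal{L}_q(x_1,\dots,x_q;\beta_0,\dots,\beta_{q+1};M)$ as follows. Let $E_{x_i}f(x)=f(x+e_i)$, $\triangle_{x_i}=E_{x_i}-1$, $\nabla_{x_i}=1-E_{x_i}^{-1}$ (with multi-index powers), and for $1\le i\le q$ let $I_i$ be the substitution $x_i\mapsto -x_i-\beta_i$ (everything else fixed) on rational functions. For $\nu\in\{0,1\}^q\setminus\{0\}$ with nonzero components at positions $i_1<\cdots<i_s$ put $$A_\nu=(x_{i_1}+\beta_{i_1}-\beta_0)(x_{i_1}+\beta_{i_1})\,\frac{\prod_{k=2}^s(x_{i_k}+x_{i_{k-1}}+\beta_{i_k})(x_{i_k}+x_{i_{k-1}}+\beta_{i_k}+1)}{\prod_{k=1}^s(2x_{i_k}+\beta_{i_k})(2x_{i_k}+\beta_{i_k}+1)}\,(x_{i_s}+\beta_{q+1}+M)(M-x_{i_s}).$$ With $\nu_j^+=\max(\nu_j,0)$, $\nu_j^-=-\min(\nu_j,0)$, for $\nu\in\{-1,0,1\}^q\setminus\{0,1\}^q$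 put $A_\nu=I^{\nu^-}(A_{\nu^++\nu^-})$, where $I^{\nu^-}$ is the composition of the $I_i$ with $\nu_i^-=1$; then $\mathcal{L}_q=\sum_{\nu\in\{-1,0,1\}^q\setminus\{0\}}(-1)^{|\nu^-|}A_\nu\triangle_x^{\nu^+}\nabla_x^{\nu^-}$. For $j=1,\dots,p$ put $\mathfrak{L}^x_j=\mathcal{L}_j(x_1,\dots,x_j;\beta_0,\dots,\beta_{j+1};x_{j+1})$ with $x_{p+1}=N$. Let $\mathfrak b$ be the algebra isomorphism from difference operators in $x=(x_1,\dots,x_p)$ with coefficients rational in $x,\beta,N$ to difference operators in $n=(n_1,\dots,n_p)$ with coefficients rational in $n,\beta,N$ determined by $\mathfrak b(N)=N$, $\mathfrak b(\beta_0)=\beta_0$, $\mathfrak b(\beta_k)=\beta_0-\beta_{p+2-k}-2N+1$ ($1\le k\le p+1$), $\mathfrak b(x_k)=n_1+\cdots+n_{p+1-k}+\beta_{p+2-k}-\beta_0+N-1$ and $\mathfrak b(E_{x_k})=E_{n_{p+1-k}}E_{n_{p+2-k}}^{-1}$ ($1\le k\le p$), with $E_{n_{p+1}}$ the identity. Put $\mathfrak{L}^n_j=\mathfrak b(\mathfrak{L}^x_j)$, and let $\mathfrak{L}^n_j(\beta_0,\gamma,N)$ be $\mathfrak{L}^n_j$ after the substitution $\beta_k=\beta_0+\gamma_1^k+k$ for $k=1,\dots,p+1$. Finally $$\tilde{\mathfrak L}^n_j=\lim_{\beta_0\to\infty}\frac1{\beta_0}\,\mathfrak{L}^n_j(\beta_0,\gamma,N),$$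 the limit being taken coefficientwise in the expansion in powers of the shifts $E_{n_i}^{\pm1}$. Conventions: if $N\notin\mathbb{N}_0$, all $n\in\mathbb{N}_0^p$ are considered; if $N\in\mathbb{N}_0$, only $n\in\mathbb{N}_0^p$ with $|n|\le N$. The real parameters are assumed to be such that the denominators occurring (in $H_p$ and, at the points $n$ considered, in the coefficients of $\tilde{\mathfrak L}^n_j$) do not vanish, apart from the factor $(-N)_{|k|}$ in the limit described next. Terms of $\tilde{\mathfrak L}^n_jH_p$ involving an index with a negative component have vanishing coefficient and are taken to be $0$. When $N\in\mathbb{N}_0$ and $|n|=N$, each term involving $H_p(k;y;\gamma;N)$ with $|k|=N+1$ is interpreted as the limit $N'\to N$ of the corresponding term with $N$ replaced by $N'\notin\mathbb{N}_0$. *)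

(* Defs.v *)
From HB Require Import structures.
From mathcomp Require Import all_boot all_order all_algebra.
From mathcomp Require Import all_classical all_reals all_analysis.

Set Implicit Arguments.
Unset Strict Implicit.
Unset Printing Implicit Defensive.

Import Order.TTheory GRing.Theory Num.Theory.
Import numFieldNormedType.Exports.

Local Open Scope classical_set_scope.
Local Open Scope ring_scope.

(* A vector (v_1, ..., v_p) is a row vector.  To keep the formulas readable,
   its components are addressed by the indices 1, ..., p through [coord],
   which is 0 at every other index. *)
Definition coord (V : nmodType) (p : nat) (v : 'rV[V]_p) (i : nat) : V :=
  \sum_(k < p | k.+1 == i) v 0 k.

(* v_1 + ... + v_k *)
Definition psum (V : nmodType) (p : nat) (v : 'rV[V]_p) (k : nat) : V :=
  \sum_(1 <= i < k.+1) coord v i.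

(* The i-th standard basis vector for 1 <= i <= p, and 0 otherwise; hence the
   shift along [basis p p.+1] is the identity. *)
Definition basis (V : pzSemiRingType) (p i : nat) : 'rV[V]_p :=
  \row_k (k.+1 == i)%:R.

Definition resize (V : nmodType) (p q : nat) (v : 'rV[V]_p) : 'rV[V]_q :=
  \row_(i < q) coord v i.+1.

Definition poch (R : pzRingType) (a : R) (k : nat) : R :=
  \prod_(i < k) (a + i%:R).

(* The factors (a+1)_n and (-N)_n of the prefactor absorb the denominators of
   the hypergeometric series: (c)_n / (c)_i = (c + i)_(n - i) for i <= n. *)
Definition hahn1 (R : realType) (n : nat) (x a b N : R) : R :=
  \sum_(i < n.+1)
    poch (- n%:R) i * poch (n%:R + a + b + 1) i * poch (- x) i / (i`!)%:R
    * (poch (a + 1 + i%:R) (n - i) * poch (- N + i%:R) (n - i)).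

(* (y_1, ..., y_p, y_(p+1)) with y_(p+1) = N - |y|. *)
Definition complete (R : realType) (p : nat) (N : R) (y : 'rV[R]_p) :
    'rV[R]_p.+1 :=
  \row_(i < p.+1) if i == ord_max then N - psum y p else coord y i.+1.

Definition hahn_gamma_den (R : realType) (p : nat) (gamma : 'rV[R]_p.+1)
    (n : 'rV[nat]_p) : R :=
  \prod_(1 <= k < p.+1) poch (coord gamma k.+1 + 1) (coord n k).

Definition hahn (R : realType) (p : nat) (n : 'rV[nat]_p) (y : 'rV[R]_p)
    (gamma : 'rV[R]_p.+1) (N : R) : R :=
  (-1) ^+ psum n p / (poch (- N) (psum n p) * hahn_gamma_den gamma n)
  * \prod_(1 <= k < p.+1)
      hahn1 (coord n k)
        (psum (complete N y) k - (psum n k.-1)%:R)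
        (2 * (psum n k.-1)%:R + psum gamma k + k%:R - 1)
        (coord gamma k.+1)
        (psum (complete N y) k.+1 - (psum n k.-1)%:R).

Definition Ly (R : realType) (p j : nat) (gamma : 'rV[R]_p.+1) (N : R)
    (f : 'rV[R]_p -> R) (y : 'rV[R]_p) : R :=
  \sum_(1 <= l < j.+2) \sum_(1 <= m < j.+2 | l != m)
    (coord (complete N y) l + coord gamma l + 1) * coord (complete N y) m
    * (f (y + basis R p l - basis R p m) - f y).

Section DifferenceOperators.

Variable R : realType.

(* A coefficient is a function of the p variables, of the parameters beta
   (of which beta 0, ..., beta p.+1 are used) and of the parameter N. *)
Definition coeff (p : nat) : Type := 'rV[R]_p -> (nat -> R) -> R -> R.

(* The list of the (a, kappa) stands for the operator
   sum a E_1^(kappa_1) ... E_p^(kappa_p), coefficients on the left. *)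
Definition diffop (p : nat) : Type := seq (coeff p * 'rV[int]_p).

Definition dop_mul_coeff (p : nat) (c : coeff p) : diffop p :=
  [:: (c, 0)].

Definition dop_comp (p : nat) (L1 L2 : diffop p) : diffop p :=
  [seq ((fun x beta N =>
           t.1 x beta N * u.1 (x + map_mx intr t.2) beta N),
        t.2 + u.2) | t <- L1, u <- L2].

Definition dop_prod (p : nat) (s : seq (diffop p)) : diffop p :=
  foldr (@dop_comp p) (dop_mul_coeff (fun _ _ _ => 1)) s.

Definition dop_delta (p : nat) (i : 'I_p) : diffop p :=
  [:: ((fun _ _ _ => 1), delta_mx 0 i); ((fun _ _ _ => -1), 0)].

Definition dop_nabla (p : nat) (i : 'I_p) : diffop p :=
  [:: ((fun _ _ _ => 1), 0); ((fun _ _ _ => -1), - delta_mx 0 i)].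

Definition dop_shifts (p : nat) (L : diffop p) : seq 'rV[int]_p :=
  undup [seq t.2 | t <- L].

Definition dop_coeff (p : nat) (L : diffop p) (kappa : 'rV[int]_p) : coeff p :=
  fun x beta N => \sum_(t <- L | t.2 == kappa) t.1 x beta N.

(* A_nu for nu in {0,1}^q, nu being given by its support S; the last argument
   is M. *)
Definition Acoef (q : nat) (S : {set 'I_q}) : coeff q := fun x beta M =>
  let pos := [seq (val i).+1 | i <- enum S] in
  let X k := coord x (nth 0 pos k) in
  let B k := beta (nth 0 pos k) in
  let s := size pos in
  (X 0%N + B 0%N - beta 0%N) * (X 0%N + B 0%N)
  * ((\prod_(1 <= k < s)
        ((X k + X k.-1 + B k) * (X k + X k.-1 + B k + 1)))
     / (\prod_(0 <= k < s) ((2 * X k + B k) * (2 * X k + B k + 1))))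
  * (X s.-1 + beta q.+1 + M) * (M - X s.-1).

(* The composition of the substitutions I_i, i in Q. *)
Definition Isub (q : nat) (Q : {set 'I_q}) (a : coeff q) : coeff q :=
  fun x beta M =>
    a (\row_i if i \in Q then - x 0 i - beta i.+1 else x 0 i) beta M.

(* nu in {-1,0,1}^q is given by the pair of the supports of nu^+ and nu^-. *)
Definition signs (q : nat) : seq ({set 'I_q} * {set 'I_q}) :=
  enum [pred nu : {set 'I_q} * {set 'I_q} |
     [disjoint nu.1 & nu.2] && (nu.1 :|: nu.2 != finset.set0)].

(* The summand of L_q for nu = (P, Q); the slot of N in the coefficients is
   used for M. *)
Definition Lterm (q : nat) (P Q : {set 'I_q}) : diffop q :=
  dop_comp
    (dop_mul_coeff (fun x beta M =>
       (-1) ^+ #|Q| * Isub Q (Acoef (P :|: Q)) x beta M))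
    (dop_comp (dop_prod [seq dop_delta i | i <- enum P])
              (dop_prod [seq dop_nabla i | i <- enum Q])).

Definition Lgen (q : nat) : diffop q :=
  flatten [seq Lterm nu.1 nu.2 | nu <- signs q].

(* L_j in x_1, ..., x_j at M = x_(j+1), where x_(p+1) = N, viewed as an
   operator in x_1, ..., x_p. *)
Definition Lx (p j : nat) : diffop p :=
  [seq ((fun x beta N =>
           t.1 (resize j x) beta (if j == p then N else coord x j.+1)),
        resize p t.2) | t <- Lgen j].

(* The isomorphism b: the images of x, of beta and of the shifts. *)
Definition b_beta (p : nat) (beta : nat -> R) (N : R) (k : nat) : R :=
  if k == 0%N then beta 0%N
  else beta 0%N - beta (p + 2 - k)%N - 2 * N + 1.

Definition b_x (p : nat) (n : 'rV[R]_p) (beta : nat -> R) (N : R) : 'rV[R]_p :=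
  \row_i (let k := i.+1 in
          psum n (p + 1 - k) + beta (p + 2 - k)%N - beta 0%N + N - 1).

Definition b_shift (p : nat) (kappa : 'rV[int]_p) : 'rV[int]_p :=
  \sum_(1 <= k < p.+1)
    coord kappa k *: (basis int p (p + 1 - k) - basis int p (p + 2 - k)).

Definition b_iso (p : nat) (L : diffop p) : diffop p :=
  [seq ((fun n beta N => t.1 (b_x n beta N) (b_beta p beta N) N),
        b_shift t.2) | t <- L].

Definition Ln (p j : nat) : diffop p := b_iso (Lx p j).

(* beta_k = beta_0 + gamma_1 + ... + gamma_k + k, also valid for k = 0. *)
Definition beta_gamma (p : nat) (gamma : 'rV[R]_p.+1) (beta0 : R) (k : nat) : R :=
  beta0 + psum gamma k + k%:R.

(* The coefficient of E_n^kappa in the limit operator. *)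
Definition Lnt_coeff (p j : nat) (kappa : 'rV[int]_p) (n : 'rV[nat]_p)
    (gamma : 'rV[R]_p.+1) (N : R) : R :=
  lim (dop_coeff (Ln p j) kappa (map_mx (fun m => m%:R) n)
         (beta_gamma gamma beta0) N / beta0 @[beta0 --> +oo]).

Definition shift_index (p : nat) (n : 'rV[nat]_p) (kappa : 'rV[int]_p) :
    'rV[int]_p := map_mx Posz n + kappa.

Definition nonneg_index (p : nat) (k : 'rV[int]_p) : bool :=
  [forall i, 0 <= k 0 i].

Definition nat_index (p : nat) (k : 'rV[int]_p) : 'rV[nat]_p :=
  map_mx absz k.

(* The limit operator applied to a family F N k, which also depends on N
   because of the limit N' -> N; the punctured filter N^' avoids the
   nonnegative integers near N. *)
Definition Lnt (p j : nat) (gamma : 'rV[R]_p.+1) (N : R)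
    (F : R -> 'rV[nat]_p -> R) (n : 'rV[nat]_p) : R :=
  \sum_(kappa <- dop_shifts (Ln p j) | nonneg_index (shift_index n kappa))
    (let k := nat_index (shift_index n kappa) in
     let term N' := Lnt_coeff j kappa n gamma N' * F N' k in
     if (N \is a Num.nat) && ((psum k p)%:R == N + 1)
     then lim (term N' @[N' --> N^'])
     else term N).

(* The factors of the denominators 2 x_i + beta_i and 2 x_i + beta_i + 1, and
   of their images under I_i, become 2 N_1^m + gamma_1^(m+1) + m + e
   with m = p + 1 - i and e in {-1,0,1} under b and beta = beta_gamma. *)
Definition Lnt_den_neq0 (p j : nat) (gamma : 'rV[R]_p.+1) (n : 'rV[nat]_p) :
    Prop :=
  forall m : nat, (p + 1 - j <= m <= p)%N ->
  forall e : R, e \in [:: -1; 0; 1] ->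
  2 * (psum n m)%:R + psum gamma m.+1 + m%:R + e != 0.

End DifferenceOperators.

Definition considered (R : realType) (p : nat) (N : R) (n : 'rV[nat]_p) : Prop :=
  N \is a Num.nat -> (psum n p)%:R <= N.

Definition mu (R : realType) (p j : nat) (gamma : 'rV[R]_p.+1)
    (n : 'rV[nat]_p) : R :=
  - (psum n j)%:R * ((psum n j)%:R + j%:R + psum gamma j.+1).

Definition kappa (R : realType) (p j : nat) (N : R) (y : 'rV[R]_p) : R :=
  N - psum y (p + 1 - j).

(* Main.v *)
Require Import Defs.
From mathcomp Require Import all_boot all_order all_algebra.
From mathcomp Require Import all_classical all_reals all_analysis.
From mathcomp Require Import ring lra zify.

Set Implicit Arguments.
Unset Strict Implicit.
Unset Printing Implicit Defensive.

Import Order.TTheory GRing.Theory Num.Theory.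
Import numFieldNormedType.Exports.
Import Defs.
Local Open Scope ring_scope.

(** The polynomial is a product of one-variable Hahn polynomials.  Put
    s_k = n_1 + ... + n_k and Y_k = y_1 + ... + y_k, with Y_(p+1) = N; the k-th
    factor is a one-variable polynomial of degree s_k - s_(k-1) which involves
    s_(k-1), s_k, Y_k, Y_(k+1) and no other partial sum.  Both spectral equations
    are obtained by moving an operator through the factors one at a time, each
    time with a contiguity relation for a single factor.

    In the variables y: the operators sum_l y_l E_l^(-1) and
    sum_l (y_l + gamma_l + 1) E_l over l <= j act on the product of the first
    j - 1 factors as multiplication by a linear function of Y_j ([lowering] and
    [raising]); the induction on j uses [hahn1_lower] and [hahn1_raise].  Their
    composition is the operator of the theorem plus a multiplication operator,
    and this yields the eigenvalue ([casimir], [argument_spectral]).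

    In the degrees n: after the isomorphism b and the limit, the variable x_i
    becomes a function of s_k with k = p + 1 - i, and A_nu becomes a product along
    the chain of those k at which nu is nonzero.  Each link of the chain is a
    quadratic polynomial evaluated at the preceding node, a node having the two
    positions s_k + g_k and - s_k according to the sign of nu, where
    g_k = gamma_1 + ... + gamma_(k+1) + k.  Expanding the differences, a node
    which is not shifted receives the contributions of nu_i = 0, 1, -1.  Their sum
    is a quadratic polynomial minus its Lagrange interpolant at the two positions,
    hence a multiple of the polynomial vanishing at both.  So the coefficient of
    every shift factors into nearest-neighbour weights ([chain_expand]).

    A sum with such coefficients can be carried out from k = p downwards.
    Writing psi for the weight that starts the product, the sum over the shift of
    s_k replaces psi at (Y_(k+1), s_k) by psi at (Y_k, s_(k-1)); there is one such
    relation for each shift of s_(k-1), namely [contig_zero], [contig_plus] and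
    [contig_minus] ([word_step], [word_sum]).  What is left at the lower end is
    psi at Y_(p+1-j); the operator omits nu = 0, and subtracting that term turns
    psi into N - Y_(p+1-j) ([index_spectral]).

    The vanishing of denominators is controlled factor by factor.  The weights
    contain the factors by which (gamma_(k+1) + 1)_(n_k) changes under a shift
    ([reduced_transfer]), and the first weight contains the factor by which
    (-N)_(|n|) changes ([start_word]); when |n| = N this factor vanishes and
    cancels the pole, which is the meaning of the limit N' -> N
    ([word_term_limit]). *)

(** * Coefficients of the one-variable Hahn polynomials *)

Lemma poch0 (R : pzRingType) (a : R) : poch a 0 = 1.
Proof. by rewrite /poch big_ord0. Qed.

Lemma pochSr (R : pzRingType) (a : R) k : poch a k.+1 = poch a k * (a + k%:R).
Proof. by rewrite /poch big_ord_recr. Qed.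

Lemma pochSl (R : pzRingType) (a b : R) k : b = a + 1 -> poch a k.+1 = a * poch b k.
Proof.
move=> ->; rewrite /poch big_ord_recl addr0; congr (_ * _).
by apply: eq_bigr => i _; rewrite lift0 -addn1 natrD -addrA [1 + _]addrC.
Qed.

Lemma factr_neq0 (R : numDomainType) k : k`!%:R != 0 :> R.
Proof. by rewrite pnatr_eq0 -lt0n fact_gt0. Qed.

Section HahnCoefficients.
Variable R : realType.
Implicit Types (a B b M N X : R) (i j n : nat).

(** Coefficient of (-X)_i in the Hahn polynomial of degree n; B stands for
    n + a + b + 1 and is kept independent, so that neighbouring degrees can share it. *)
Definition hahn_coef B a M n i : R :=
  if (i <= n)%N then
    (-1) ^+ i * n`!%:R / (i`!%:R * (n - i)`!%:R) * poch B i
    * poch (a + 1 + i%:R) (n - i) * poch (- M + i%:R) (n - i)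
  else 0.

Lemma poch_nat_fact n i : (i <= n)%N ->
  poch (- n%:R : R) i = (-1) ^+ i * n`!%:R / (n - i)`!%:R.
Proof.
elim: i => [|i IH] lin.
  by rewrite poch0 subn0 expr0 mul1r divff ?factr_neq0.
rewrite pochSr IH; last exact: ltnW.
have e : (n - i = (n - i.+1).+1)%N by lia.
rewrite e factS natrM exprSr.
have -> : - n%:R + i%:R = - (n - i.+1).+1%:R :> R.
  by rewrite -e natrB ?opprB 1?addrC //; exact: ltnW.
by field; rewrite factr_neq0 nat1r pnatr_eq0.
Qed.

(** The number K of terms is free, which lets polynomials of different degrees be
    compared over one index range. *)
Lemma hahn1E n X a b M K B : (n < K)%N -> B = n%:R + a + b + 1 ->
  hahn1 n X a b M = \sum_(i < K) hahn_coef B a M n i * poch (- X) i.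
Proof.
move=> nK ->; rewrite /hahn1.
rewrite (big_ord_widen K (fun i => poch (- n%:R) i * poch (n%:R + a + b + 1) i
    * poch (- X) i / (i`!)%:R
    * (poch (a + 1 + i%:R) (n - i) * poch (- M + i%:R) (n - i)))) //.
rewrite big_mkcond /=; apply: eq_bigr => i _; rewrite /hahn_coef ltnS.
case: leqP => lin; last by rewrite mul0r.
rewrite poch_nat_fact //.
by field; rewrite !factr_neq0.
Qed.

Lemma hahn_coefE B a M n i j U V : n = (i + j)%N -> U = a + 1 + i%:R -> V = - M + i%:R ->
  hahn_coef B a M n i
  = (-1) ^+ i * n`!%:R / (i`!%:R * j`!%:R) * poch B i * poch U j * poch V j.
Proof. by move=> -> -> ->; rewrite /hahn_coef leq_addr addKn. Qed.

Lemma hahn_coef_gt B a M n i : (n < i)%N -> hahn_coef B a M n i = 0.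
Proof. by rewrite /hahn_coef ltnNge => /negbTE ->. Qed.

(** The parameter B enters only through (B)_i, so that B can be lowered at the cost
    of a linear factor; this brings all terms of a contiguity relation to the same B. *)
Lemma hahn_coef_succB B a M n i : B * hahn_coef (B + 1) a M n i = (B + i%:R) * hahn_coef B a M n i.
Proof.
rewrite /hahn_coef; case: ifP => _; last by rewrite !mulr0.
have e : B * poch (B + 1) i = poch B i * (B + i%:R).
  by rewrite -pochSr (@pochSl _ B (B + 1)).
transitivity ((-1) ^+ i * n`!%:R / (i`!%:R * (n - i)`!%:R) * (B * poch (B + 1) i)
    * poch (a + 1 + i%:R) (n - i) * poch (- M + i%:R) (n - i)); first by ring.
by rewrite e; ring.
Qed.

Lemma mulr_hahn_coef_pred B a M n i : (n <= i)%N -> n%:R * hahn_coef B a M n.-1 i = 0.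
Proof. by case: n => [|n] ni; rewrite ?mul0r // hahn_coef_gt ?mulr0. Qed.

Lemma mulr_hahn_coef_pred2 B a M n i : (n <= i.+1)%N ->
  n%:R * (n%:R - 1) * hahn_coef B a M n.-2 i = 0.
Proof.
by case: n => [|[|n]] ni; rewrite ?mul0r ?subrr ?mulr0 ?mul0r // hahn_coef_gt ?mulr0.
Qed.

(** Coefficient form of [contig_plus]: for n = i + j every term is, up to (B)_i and
    factorials, a rational multiple of (a + 3 + i)_(j-2) (1 - M + i)_(j-2), except near
    the top degree, where some terms vanish; hence the cases j = 0, j = 1 and j >= 2. *)
Lemma contig_plus_coef a c M n i B D :
  B = n%:R + a + c -> D = 2 * n%:R + a + c ->
  D != 0 -> D + 1 != 0 -> D - 1 != 0 -> (i <= n)%N ->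
  (B + i%:R) * (B + 1 + i%:R) / (D * (D + 1)) * hahn_coef B (a + 2) (M - 1) n i
  - 2 * (B + i%:R) * (n%:R + c - 1) / ((D + 1) * (D - 1)) * - (M + (1 + a + c) / 2)
    * (n%:R * hahn_coef B (a + 2) (M - 1) n.-1 i)
  + (n%:R + c - 1) * (n%:R + c - 2) / (D * (D - 1)) *
    ((M + B) * (M - n%:R + 1)) * (n%:R * (n%:R - 1) * hahn_coef B (a + 2) (M - 1) n.-2 i)
  = hahn_coef B a M n i - (i.+1)%:R * hahn_coef B a M n i.+1.
Proof.
move=> eB eD D0 D1 D2 lin.
have [j en] : exists j, n = (i + j)%N by exists (n - i)%N; rewrite subnKC.
subst n.
have f0 := @factr_neq0 R.
have d m x := @hahn_coefE B (a + 2) (M - 1) m i x (a + i%:R + 3) (- M + i%:R + 1).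
have dj m x := @hahn_coefE B a M m i x (a + i%:R + 1) (- M + i%:R).
have di m x := @hahn_coefE B a M m i.+1 x (a + i%:R + 2) (- M + i%:R + 1).
have H1 : a + i%:R + 3 = a + 2 + 1 + i%:R by ring.
have H2 : a + i%:R + 2 = a + 1 + i.+1%:R by rewrite -natr1; ring.
have H3 : a + i%:R + 1 = a + 1 + i%:R by ring.
have H4 : - M + i%:R + 1 = - (M - 1) + i%:R by ring.
have H5 : - M + i%:R + 1 = - M + i.+1%:R by rewrite -natr1; ring.
have k1 x : poch (a + i%:R + 1) x.+1 = (a + i%:R + 1) * poch (a + i%:R + 2) x.
  by apply: pochSl; ring.
have k2 x : poch (a + i%:R + 2) x.+1 = (a + i%:R + 2) * poch (a + i%:R + 3) x.
  by apply: pochSl; ring.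
have k3 x : poch (- M + i%:R) x.+1 = (- M + i%:R) * poch (- M + i%:R + 1) x.
  by apply: pochSl; ring.
case: j D D0 D1 D2 lin eB eD => [|[|j]] D D0 D1 D2 lin eB eD.
- rewrite addn0 in D0 D1 D2 lin eB eD *.
  rewrite mulr_hahn_coef_pred // mulr_hahn_coef_pred2 // (@hahn_coef_gt B _ _ _ i.+1) //.
  rewrite (d i 0%N) ?(dj i 0%N) ?addn0 // !poch0 eB.
  rewrite eD in D0 D1 D2 *.
  by field; rewrite !f0 D0 D1 D2.
- rewrite addn1 in D0 D1 D2 lin eB eD *.
  rewrite mulr_hahn_coef_pred2; last exact: leqnn.
  rewrite (d i.+1 1%N) ?(d i 0%N) ?(dj i.+1 1%N) ?(di _ 0%N) ?addn0 ?addn1 //.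
  rewrite !factS fact0 !natrM !pochSr !poch0 exprSr.
  rewrite eB eD in D0 D1 D2 *.
  by field; rewrite ?nat1r -?natrD ?D0 ?D1 ?D2 ?f0 ?pnatr_eq0 ?addnS.
- rewrite (d _ j.+2) // (d _ j.+1) ?(d _ j) ?(dj _ j.+2) ?(di _ j.+1) //; [|lia..].
  rewrite k1 k2 k3 !pochSr !addnS /= !factS !natrM exprSr.
  rewrite eB eD in D0 D1 D2 *.
  by field; rewrite ?nat1r -?natrD ?D0 ?D1 ?D2 ?f0 ?pnatr_eq0 ?addnS.
Qed.

(** Multiplication by X sends (-X)_i to (-X)_(i+1), which shifts the index of the
    coefficients by one. *)
Definition hahn_coef_prev B a M n i : R := if i is i'.+1 then hahn_coef B a M n i' else 0.

(** Coefficient form of [contig_zero], by the same comparison of cofactors; the degree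
    n + 1 gives one more top case and the shifted index a bottom case. *)
Lemma contig_zero_coef a c M n i B D :
  B = n%:R + a + c -> D = 2 * n%:R + a + c ->
  D != 0 -> D + 1 != 0 -> D - 1 != 0 -> (i <= n.+1)%N ->
  - (B + i%:R) / (D * (D + 1)) * hahn_coef B a M n.+1 i
  + (1 - B * (n%:R + c) / (D * (D + 1)) - n%:R * (n%:R + a) / (D * (D - 1)))
    * - (M + (1 + a + c) / 2) * hahn_coef B a M n i
  - (n%:R + a) * (n%:R + c - 1) / (D * (D - 1)) *
    ((M + B) * (M - n%:R + 1)) * (n%:R * hahn_coef (B - 1) a M n.-1 i)
  = - (i%:R + (1 + a) / 2) * hahn_coef B a M n i + hahn_coef_prev B a M n i.
Proof.
move=> eB eD D0 D1 D2 lin.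
have f0 := @factr_neq0 R.
have d m i' x B' := @hahn_coefE B' a M m i' x (a + i'%:R + 1) (- M + i'%:R).
have H i' : a + i'%:R + 1 = a + 1 + i'%:R by ring.
have k1 i' x : poch (a + i'%:R + 1) x.+1 = (a + i'%:R + 1) * poch (a + i'.+1%:R + 1) x.
  by apply: pochSl; rewrite -natr1; ring.
have k2 i' x : poch (- M + i'%:R) x.+1 = (- M + i'%:R) * poch (- M + i'.+1%:R) x.
  by apply: pochSl; rewrite -natr1; ring.
have kB i' : poch (B - 1) i'.+1 = (B - 1) * poch B i'.
  by apply: pochSl; ring.
case: i lin => [|i] lin; rewrite /hahn_coef_prev.
- case: n lin eB eD => [|n] lin eB eD.
  + rewrite mul0r (d 1%N 0%N 1%N) // (d 0%N 0%N 0%N) // !pochSr !poch0 !expr0.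
    rewrite mulr0n ?mulr0 !add0r in eB eD *.
    rewrite eB eD in D0 D1 D2 *.
    by field; rewrite ?D0 ?D1 ?D2 ?f0.
  + rewrite (d n.+2 0%N n.+2) // (d n.+1 0%N n.+1) // (d n 0%N n) // !pochSr !poch0 !expr0.
    rewrite !factS !natrM.
    rewrite eB eD in D0 D1 D2 *.
    by field; rewrite ?nat1r -?natrD ?D0 ?D1 ?D2 ?f0 ?pnatr_eq0 ?addnS.
- have [j en] : exists j, n = (i + j)%N by exists (n - i)%N; rewrite subnKC.
  subst n; case: j D0 D1 D2 lin eB eD => [|[|j]] D0 D1 D2 lin eB eD.
  + rewrite addn0 in D0 D1 D2 lin eB eD *.
    rewrite mulr_hahn_coef_pred // (@hahn_coef_gt _ _ _ i i.+1) //.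
    rewrite (d i.+1 i.+1 0%N) ?addn0 // (d i i 0%N) ?addn0 //.
    rewrite !pochSr !poch0 exprSr factS natrM.
    rewrite eB eD in D0 D1 D2 *.
    by field; rewrite ?nat1r -?natrD ?D0 ?D1 ?D2 ?f0 ?pnatr_eq0 ?addnS.
  + rewrite addn1 in D0 D1 D2 lin eB eD *.
    rewrite mulr_hahn_coef_pred // (d _ i.+1 1%N) ?addn1 // (d _ i.+1 0%N) ?addn0 // (d _ i 1%N) ?addn1 //.
    rewrite !pochSr !poch0 exprSr !factS !natrM.
    rewrite eB eD in D0 D1 D2 *.
    by field; rewrite ?nat1r -?natrD ?D0 ?D1 ?D2 ?f0 ?pnatr_eq0 ?addnS.
  + rewrite (d (i + j.+2).+1 i.+1 j.+2) ?(d (i + j.+2)%N i.+1 j.+1)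
      ?(d (i + j.+2).-1 i.+1 j) ?(d _ i j.+2) //; [|lia..].
    rewrite kB (k1 i) (k2 i) !pochSr !addnS /= !factS !natrM exprSr.
    rewrite eB eD in D0 D1 D2 *.
    by field; rewrite ?nat1r -?natrD ?D0 ?D1 ?D2 ?f0 ?pnatr_eq0 ?addnS.
Qed.

(** Coefficient form of [contig_minus]; the multiplier (X + a)(X + 1) shifts the index
    by up to two, so there are two exceptional indices at either end. *)
Lemma contig_minus_coef a c M n i B D :
  B = n%:R + a + c -> D = 2 * n%:R + a + c ->
  D != 0 -> D + 1 != 0 -> D - 1 != 0 -> (i <= n.+2)%N ->
  1 / (D * (D + 1)) * hahn_coef B (a - 2) (M + 1) n.+2 i
  - 2 * (n%:R + a) / ((D + 1) * (D - 1)) * - (M + (1 + a + c) / 2)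
    * hahn_coef (B - 1) (a - 2) (M + 1) n.+1 i
  + (n%:R + a) * (n%:R + a - 1) / (D * (D - 1)) *
    ((M + B) * (M - n%:R + 1)) * hahn_coef (B - 2) (a - 2) (M + 1) n i
  = - (a + i%:R - 1) * hahn_coef_prev B a M n i
    + (if i is i'.+1 then hahn_coef_prev B a M n i' else 0).
Proof.
move=> eB eD D0 D1 D2 lin.
have f0 := @factr_neq0 R.
have [j en] : exists j, n.+2 = (i + j)%N by exists (n.+2 - i)%N; rewrite subnKC.
set U := a + i%:R - 1; set V := - M + i%:R - 1.
have d B' m x := @hahn_coefE B' (a - 2) (M + 1) m i x U V.
have kU x : U * poch (U + 1) x = poch U x.+1 by rewrite (@pochSl _ U (U + 1)).
have kV x : poch (V - 1) x.+1 = (V - 1) * poch V x by apply: pochSl; ring.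
have kB1 i' : poch (B - 1) i'.+1 = (B - 1) * poch B i'.
  by apply: pochSl; ring.
have kB2 i' : poch (B - 2) i'.+1 = (B - 2) * poch (B - 1) i'.
  by apply: pochSl; ring.
have H1 : U = a - 2 + 1 + i%:R by rewrite /U; ring.
have H2 : V = - (M + 1) + i%:R by rewrite /V; ring.
case: i en lin @U @V d kU kV H1 H2 => [|i] en lin U V d kU kV H1 H2.
  case: j en => [|[|j]] en; try lia.
  have {}en : n = j by lia.
  subst n.
  rewrite (d B j.+2 j.+2) // (d (B - 1) j.+1 j.+1) // (d (B - 2) j j) //.
  rewrite !pochSr !poch0 expr0 !factS !natrM /hahn_coef_prev.
  rewrite eB eD in D0 D1 D2 *; rewrite /U /V -?natr1.
  by field; rewrite ?natr1 ?nat1r -?natrD ?D0 ?D1 ?D2 ?f0 ?pnatr_eq0 ?addnS.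
case: i en lin @U @V d kU kV H1 H2 => [|i] en lin U V d kU kV H1 H2.
  have d1 m x := @hahn_coefE B a M m 0 x (U + 1) V.
  have H3 : U + 1 = a + 1 + 0%:R by rewrite /U -natr1; ring.
  have H4 : V = - M + 0%:R by rewrite /V -natr1; ring.
  case: j en => [|[|j]] en; try lia.
  - have {}en : n = 0%N by lia.
    subst n; rewrite mulr0n ?mulr0 !add0r in eB eD *.
    rewrite (d B 2%N 1%N) // (d (B - 1) 1%N 0%N) //.
    rewrite /hahn_coef_prev (d1 0%N 0%N) // !pochSr !poch0.
    rewrite eB eD in D0 D1 D2 *; rewrite /U /V -?natr1.
 by field; rewrite ?natr1 ?nat1r -?natrD ?D0 ?D1 ?D2 ?f0 ?pnatr_eq0 ?addnS.
  - have {}en : n = j.+1 by lia.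
    subst n.
    rewrite (d B j.+3 j.+2) // (d (B - 1) j.+2 j.+1) // (d (B - 2) j.+1 j) //.
    have -> : - (a + 1%:R - 1) * hahn_coef_prev B a M j.+1 1
       = - (U * poch (U + 1) j.+1) * poch V j.+1.
      by rewrite /hahn_coef_prev (d1 j.+1 j.+1) // poch0 expr0 fact0 -/U; field; rewrite !f0.
    rewrite kU kB1 kB2 !pochSr !poch0 !factS !natrM /hahn_coef_prev expr1.
    rewrite eB eD in D0 D1 D2 *; rewrite /U /V -?natr1.
 by field; rewrite ?natr1 ?nat1r -?natrD ?D0 ?D1 ?D2 ?f0 ?pnatr_eq0 ?addnS.
have d1 m x := @hahn_coefE B a M m i.+1 x (U + 1) V.
have H3 : U + 1 = a + 1 + i.+1%:R by rewrite /U -!natr1; ring.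
have H4 : V = - M + i.+1%:R by rewrite /V -!natr1; ring.
have d2 m x := @hahn_coefE B a M m i x U (V - 1).
have H5 : U = a + 1 + i%:R by rewrite /U -!natr1; ring.
have H6 : V - 1 = - M + i%:R by rewrite /V -!natr1; ring.
rewrite /hahn_coef_prev.
case: j en => [|[|j]] en.
- have {}en : n = i by lia.
  subst n; rewrite (@hahn_coef_gt _ _ _ i i.+2) // (@hahn_coef_gt _ _ _ i i.+1) //
    (@hahn_coef_gt _ _ _ i.+1 i.+2) //.
  rewrite (d B i.+2 0%N) ?addn0 // (d2 i 0%N) ?addn0 //.
  rewrite !poch0 !pochSr !factS !natrM !exprSr.
  rewrite eB eD in D0 D1 D2 *; rewrite /U /V -?natr1.
 by field; rewrite ?natr1 ?nat1r -?natrD ?D0 ?D1 ?D2 ?f0 ?pnatr_eq0 ?addnS.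
- have {}en : n = i.+1 by lia.
  subst n; rewrite (@hahn_coef_gt _ _ _ i.+1 i.+2) //.
  rewrite (d B i.+3 1%N) ?addn1 // (d (B - 1) i.+2 0%N) ?addn0 //.
  rewrite (d1 i.+1 0%N) ?addn0 // (d2 i.+1 1%N) ?addn1 //.
  rewrite kB1 !pochSr !poch0 !factS !natrM !exprSr.
  rewrite eB eD in D0 D1 D2 *; rewrite /U /V -?natr1.
 by field; rewrite ?natr1 ?nat1r -?natrD ?D0 ?D1 ?D2 ?f0 ?pnatr_eq0 ?addnS.
- have {}en : n = (i + j.+2)%N by lia.
  subst n; rewrite (d B (i + j.+2).+2 j.+2) // (d (B - 1) (i + j.+2).+1 j.+1) ?(d (B - 2) _ j) //; [|lia..].
  rewrite (d2 _ j.+2) //.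
  have -> : - U * hahn_coef B a M (i + j.+2) i.+1 = - (-1) ^+ i.+1 * (i + j.+2)`!%:R / (i.+1`!%:R * j.+1`!%:R)
     * poch B i.+1 * (U * poch (U + 1) j.+1) * poch V j.+1.
    by rewrite (d1 _ j.+1) //; [ring | lia].
  rewrite kU kV kB2 !kB1 !pochSr !addnS !factS !natrM !exprSr.
  rewrite eB eD in D0 D1 D2 *; rewrite /U /V -?natr1.
 by field; rewrite ?natr1 ?nat1r -?natrD ?D0 ?D1 ?D2 ?f0 ?pnatr_eq0 ?addnS.
Qed.
End HahnCoefficients.

(** * Contiguity relations in the degree *)

Section HahnContiguity.
Variable R : realType.
Implicit Types (a B D c M X z : R) (i n : nat).

(** The change of basis from (z)_i to (z+1)_i, needed when the relation shifts X. *)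
Lemma poch_expand z i : poch z i.+1 = poch (z + 1) i.+1 - i.+1%:R * poch (z + 1) i.
Proof. by rewrite (@pochSl _ z (z + 1)) // pochSr -natr1; ring. Qed.

Lemma sum_poch_expand (f : nat -> R) z K : f K = 0 ->
  \sum_(i < K) f i * poch z i
  = \sum_(i < K) (f i - i.+1%:R * f i.+1) * poch (z + 1) i.
Proof.
move=> fK.
suff H L : \sum_(i < L.+1) f i * poch z i
  = \sum_(i < L.+1) (f i - i.+1%:R * f i.+1) * poch (z + 1) i
    + L.+1%:R * f L.+1 * poch (z + 1) L.
  by case: K fK => [|K] fK; [rewrite !big_ord0 | rewrite H fK mulr0 mul0r addr0].
elim: L => [|L IH]; first by rewrite !big_ord1 /= !poch0; ring.
by rewrite big_ord_recr /= IH [in RHS]big_ord_recr /= (poch_expand z); ring.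
Qed.

Lemma sum_shift (f g : nat -> R) K :
  \sum_(i < K) f i * g i.+1
  = \sum_(i < K.+1) (if nat_of_ord i is i'.+1 then f i' else 0) * g i.
Proof. by rewrite big_ord_recl mul0r add0r. Qed.

(** Relation between degrees n, n - 1, n - 2 at a + 2, X - 1, M - 1: the effect of raising
    the lower partial sum of degrees by one.  Here B = s_k + s_(k-1) + g_k and
    D = 2 s_k + g_k in the application. *)
Lemma contig_plus n X a c M B D :
  B = n%:R + a + c -> D = 2 * n%:R + a + c ->
  D != 0 -> D + 1 != 0 -> D - 1 != 0 ->
  B * (B + 1) / (D * (D + 1)) * hahn1 n (X - 1) (a + 2) (c - 1) (M - 1)
  - 2 * B * (n%:R + c - 1) / ((D + 1) * (D - 1)) * - (M + (1 + a + c) / 2)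
    * (n%:R * hahn1 n.-1 (X - 1) (a + 2) (c - 1) (M - 1))
  + (n%:R + c - 1) * (n%:R + c - 2) / (D * (D - 1)) *
    ((M + B) * (M - n%:R + 1))
    * (n%:R * (n%:R - 1) * hahn1 n.-2 (X - 1) (a + 2) (c - 1) (M - 1))
  = hahn1 n X a (c - 1) M.
Proof.
move=> eB eD D0 D1 D2.
have eX : - (X - 1) = - X + 1 by ring.
have e1 : n%:R * hahn1 n.-1 (X - 1) (a + 2) (c - 1) (M - 1)
   = \sum_(i < n.+1) n%:R * hahn_coef (B + 1) (a + 2) (M - 1) n.-1 i * poch (- X + 1) i.
  case: n eB eD => [|n] eB eD.
    by rewrite mul0r big1 // => i _; rewrite !mul0r.
  rewrite (@hahn1E _ _ _ _ _ _ n.+2 (B + 1)); [|by lia|by rewrite eB -natr1 /=; ring].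
  by rewrite mulr_sumr eX; apply: eq_bigr => i _; rewrite mulrA.
have e2 : n%:R * (n%:R - 1) * hahn1 n.-2 (X - 1) (a + 2) (c - 1) (M - 1)
   = \sum_(i < n.+1) n%:R * (n%:R - 1) * hahn_coef B (a + 2) (M - 1) n.-2 i * poch (- X + 1) i.
  clear e1; case: n eB eD => [|[|n]] eB eD.
  - by rewrite !mul0r big1 // => i _; rewrite !mul0r.
  - by rewrite subrr mulr0 !mul0r big1 // => i _; rewrite !mul0r.
  rewrite (@hahn1E _ _ _ _ _ _ n.+3 B); [|by lia|by rewrite eB -!natr1 /=; ring].
  by rewrite mulr_sumr eX; apply: eq_bigr => i _; rewrite mulrA.
rewrite e1 e2 (@hahn1E _ n (X - 1) _ _ _ n.+1 (B + 1 + 1)) //; last by rewrite eB; ring.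
rewrite (@hahn1E _ n X _ _ _ n.+1 B) //; last by rewrite eB; ring.
rewrite (@sum_poch_expand (hahn_coef B a M n)) ?hahn_coef_gt // eX.
rewrite !mulr_sumr -sumrB -big_split /=; apply: eq_bigr => i _.
have lin : (i <= n)%N by rewrite -ltnS.
rewrite -(@contig_plus_coef _ a c M n i B D eB eD D0 D1 D2 lin).
have h1 := @hahn_coef_succB _ B (a + 2) (M - 1) n i.
have h2 := @hahn_coef_succB _ (B + 1) (a + 2) (M - 1) n i.
have h3 := @hahn_coef_succB _ B (a + 2) (M - 1) n.-1 i.
transitivity (((B * ((B + 1) * hahn_coef (B + 1 + 1) (a + 2) (M - 1) n i)) / (D * (D + 1))
  - 2 * (n%:R + c - 1) / ((D + 1) * (D - 1)) * - (M + (1 + a + c) / 2)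
    * (n%:R * (B * hahn_coef (B + 1) (a + 2) (M - 1) n.-1 i))
  + (n%:R + c - 1) * (n%:R + c - 2) / (D * (D - 1)) *
    ((M + B) * (M - n%:R + 1)) * (n%:R * (n%:R - 1) * hahn_coef B (a + 2) (M - 1) n.-2 i))
   * poch (- X + 1) i); first by ring.
rewrite h2 mulrCA h1 h3; congr (_ * _); ring.
Qed.

(** The three-term recurrence of the Hahn polynomials, in the normalization without
    denominators in M. *)
Lemma contig_zero n X a c M B D :
  B = n%:R + a + c -> D = 2 * n%:R + a + c ->
  D != 0 -> D + 1 != 0 -> D - 1 != 0 ->
  - B / (D * (D + 1)) * hahn1 n.+1 X a (c - 1) M
  + (1 - B * (n%:R + c) / (D * (D + 1)) - n%:R * (n%:R + a) / (D * (D - 1)))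
    * - (M + (1 + a + c) / 2) * hahn1 n X a (c - 1) M
  - (n%:R + a) * (n%:R + c - 1) / (D * (D - 1)) *
    ((M + B) * (M - n%:R + 1)) * (n%:R * hahn1 n.-1 X a (c - 1) M)
  = - (X + (1 + a) / 2) * hahn1 n X a (c - 1) M.
Proof.
move=> eB eD D0 D1 D2.
have e1 : n%:R * hahn1 n.-1 X a (c - 1) M
   = \sum_(i < n.+2) n%:R * hahn_coef (B - 1) a M n.-1 i * poch (- X) i.
  case: n eB eD => [|n] eB eD.
    by rewrite mul0r big1 // => i _; rewrite !mul0r.
  rewrite (@hahn1E _ _ _ _ _ _ n.+3 (B - 1)); [|by lia|by rewrite eB -natr1 /=; ring].
  by rewrite mulr_sumr; apply: eq_bigr => i _; rewrite mulrA.
rewrite e1 (@hahn1E _ n.+1 X _ _ _ n.+2 (B + 1)) //; last by rewrite eB -natr1; ring.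
have -> : - (X + (1 + a) / 2) * hahn1 n X a (c - 1) M
   = \sum_(i < n.+2) (- (i%:R + (1 + a) / 2) * hahn_coef B a M n i + hahn_coef_prev B a M n i)
       * poch (- X) i.
  rewrite [RHS](eq_bigr (fun i : 'I_n.+2 =>
    - (i%:R + (1 + a) / 2) * hahn_coef B a M n i * poch (- X) i
    + hahn_coef_prev B a M n i * poch (- X) i)); last by move=> i _; ring.
  rewrite big_split /= -(@sum_shift (hahn_coef B a M n) (poch (- X))).
  rewrite big_ord_recr /= hahn_coef_gt // mulr0 mul0r addr0 -big_split /=.
  rewrite (@hahn1E _ n X _ _ _ n.+1 B) //; last by rewrite eB; ring.
  by rewrite mulr_sumr; apply: eq_bigr => i _; rewrite pochSr; ring.
rewrite (@hahn1E _ n X _ _ _ n.+2 B) //; last by rewrite eB; ring.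
rewrite !mulr_sumr -big_split -sumrB /=; apply: eq_bigr => i _.
have lin : (i <= n.+1)%N by rewrite -ltnS.
rewrite -(@contig_zero_coef _ a c M n i B D eB eD D0 D1 D2 lin).
have h1 := @hahn_coef_succB _ B a M n.+1 i.
transitivity ((- (B * hahn_coef (B + 1) a M n.+1 i) / (D * (D + 1))
  + (1 - B * (n%:R + c) / (D * (D + 1)) - n%:R * (n%:R + a) / (D * (D - 1)))
    * - (M + (1 + a + c) / 2) * hahn_coef B a M n i
  - (n%:R + a) * (n%:R + c - 1) / (D * (D - 1)) *
    ((M + B) * (M - n%:R + 1)) * (n%:R * hahn_coef (B - 1) a M n.-1 i)) * poch (- X) i);
  first by ring.
rewrite h1; congr (_ * _); ring.
Qed.

(** The counterpart of [contig_plus] when the lower partial sum is lowered by one. *)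
Lemma contig_minus n X a c M B D :
  B = n%:R + a + c -> D = 2 * n%:R + a + c ->
  D != 0 -> D + 1 != 0 -> D - 1 != 0 ->
  1 / (D * (D + 1)) * hahn1 n.+2 (X + 1) (a - 2) (c - 1) (M + 1)
  - 2 * (n%:R + a) / ((D + 1) * (D - 1)) * - (M + (1 + a + c) / 2)
    * hahn1 n.+1 (X + 1) (a - 2) (c - 1) (M + 1)
  + (n%:R + a) * (n%:R + a - 1) / (D * (D - 1)) *
    ((M + B) * (M - n%:R + 1)) * hahn1 n (X + 1) (a - 2) (c - 1) (M + 1)
  = (X + a) * (X + 1) * hahn1 n X a (c - 1) M.
Proof.
move=> eB eD D0 D1 D2.
rewrite (@hahn1E _ n.+2 _ _ _ _ n.+3 B) //; last by rewrite eB -!natr1; ring.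
rewrite (@hahn1E _ n.+1 _ _ _ _ n.+3 (B - 1)) //; last by rewrite eB -!natr1; ring.
rewrite (@hahn1E _ n (X + 1) _ _ _ n.+3 (B - 2)); [|by lia|by rewrite eB; ring].
have -> : (X + a) * (X + 1) * hahn1 n X a (c - 1) M
   = \sum_(i < n.+3) (- (a + i%:R - 1) * hahn_coef_prev B a M n i
    + (if nat_of_ord i is i'.+1 then hahn_coef_prev B a M n i' else 0)) * poch (- (X + 1)) i.
  rewrite [RHS](eq_bigr (fun i : 'I_n.+3 =>
    - (a + i%:R - 1) * hahn_coef_prev B a M n i * poch (- (X + 1)) i
    + (if nat_of_ord i is i'.+1 then hahn_coef_prev B a M n i' else 0) * poch (- (X + 1)) i));
    last by move=> i _; exact: mulrDl.
  rewrite big_split /= -(@sum_shift (hahn_coef_prev B a M n) (poch (- (X + 1)))).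
  rewrite (big_ord_recr n.+2) /= hahn_coef_gt // mulr0 mul0r addr0 -big_split /=.
  rewrite (@hahn1E _ n X _ _ _ n.+1 B) //; last by rewrite eB; ring.
  rewrite [in RHS]big_ord_recl /hahn_coef_prev /= mulr0 !mul0r !add0r.
  rewrite mulr_sumr; apply: eq_bigr => i _.
  have eS k : poch (- (X + 1)) k.+1 = - (X + 1) * poch (- X) k by apply: pochSl; ring.
  rewrite /bump /= add1n add0n !eS pochSr -natr1.
  by ring.
rewrite !mulr_sumr -sumrB -big_split /=; apply: eq_bigr => i _.
have lin : (i <= n.+2)%N by rewrite -ltnS.
rewrite -(@contig_minus_coef _ a c M n i B D eB eD D0 D1 D2 lin).
by ring.
Qed.
End HahnContiguity.

(** * Contiguity relations in the argument *)

Section HahnInArgument.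
Variable R : realType.
Implicit Types (a b N X : R) (i n : nat).

(** It holds term by term, since X (1 - X)_i = (X - i)(-X)_i and
    (N - i)(-N + 1 + i)_(n-i) = (N - n)(-N + i)_(n-i). *)
Lemma hahn1_lower n X a b N :
  X * hahn1 n (X - 1) a b (N - 1) + (N - X) * hahn1 n X a b (N - 1)
  = (N - n%:R) * hahn1 n X a b N.
Proof.
rewrite !(@hahn1E _ n _ a b _ n.+1 _ (ltnSn n) erefl) !mulr_sumr -big_split /=.
apply: eq_bigr => -[i /= lin] _; rewrite ltnS in lin.
have e1 : X * poch (- (X - 1)) i = (X - i%:R) * poch (- X) i.
  have : poch (- X) i.+1 = - X * poch (- (X - 1)) i by apply: pochSl; ring.
  by rewrite pochSr => e; lra.
set B := n%:R + a + b + 1.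
have e2 : (N - i%:R) * hahn_coef B a (N - 1) n i = (N - n%:R) * hahn_coef B a N n i.
  have [j en] : exists j, n = (i + j)%N by exists (n - i)%N; rewrite subnKC.
  have : poch (- N + i%:R) j.+1 = (- N + i%:R) * poch (- (N - 1) + i%:R) j.
    by apply: pochSl; ring.
  rewrite pochSr => e.
  rewrite !(@hahn_coefE _ B a _ n i j _ _ en erefl erefl).
  have -> : N - i%:R = - (- N + i%:R) by ring.
  have -> : N - n%:R = - (- N + i%:R + j%:R) by rewrite en natrD; ring.
  set u := (-1) ^+ i * _ / _ * _.
  transitivity (- (u * poch (a + 1 + i%:R) j * ((- N + i%:R) * poch (- (N - 1) + i%:R) j))).
    by ring.
  by rewrite -e; ring.
transitivity ((X * poch (- (X - 1)) i + (N - X) * poch (- X) i) * hahn_coef B a (N - 1) n i).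
  by ring.
rewrite e1; transitivity ((N - i%:R) * hahn_coef B a (N - 1) n i * poch (- X) i); first by ring.
by rewrite e2; ring.
Qed.

(** Unlike [hahn1_lower] it mixes neighbouring coefficients: expanding
    (X + a + 1)(-X - 1)_i produces (-X)_i and (-X)_(i-1). *)
Lemma hahn1_raise n X a b N :
  (X + a + 1) * hahn1 n (X + 1) a b (N + 1)
  + (N - X + b + 1) * hahn1 n X a b (N + 1)
  = (N + n%:R + a + b + 2) * hahn1 n X a b N.
Proof.
rewrite !(@hahn1E _ n _ a b _ n.+1 _ (ltnSn n) erefl) !mulr_sumr.
set B := n%:R + a + b + 1.
pose g i := i%:R * (i%:R + a) * hahn_coef B a (N + 1) n i.
transitivity (\sum_(i < n.+1) ((N + i%:R + a + b + 2) * hahn_coef B a (N + 1) n i * poch (- X) i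
   - g i * poch (- X) i.-1)).
  rewrite -big_split; apply: eq_bigr => i _ /=; rewrite /g.
  case: (nat_of_ord i) => [|k]; first by rewrite !poch0; ring.
  have e1 : poch (- (X + 1)) k.+1 = - (X + 1) * poch (- X) k by apply: pochSl; ring.
  by rewrite e1 pochSr /= -natr1; ring.
have -> : \sum_(i < n.+1) ((N + i%:R + a + b + 2) * hahn_coef B a (N + 1) n i * poch (- X) i
   - g i * poch (- X) i.-1)
  = \sum_(i < n.+1) ((N + i%:R + a + b + 2) * hahn_coef B a (N + 1) n i - g i.+1) * poch (- X) i.
  rewrite sumrB [X in _ - X = _]big_ord_recl /= {1}/g !mul0r add0r.
  have -> : \sum_(i < n) g (bump 0 i) * poch (- X) (bump 0 i).-1
    = \sum_(i < n.+1) g i.+1 * poch (- X) i.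
    have gn : g n.+1 = 0 by rewrite /g hahn_coef_gt // mulr0.
    by rewrite [RHS]big_ord_recr /= gn mul0r addr0; apply: eq_bigr.
  by rewrite -sumrB; apply: eq_bigr => i _; rewrite mulrBl.
apply: eq_bigr => -[i /= lin] _; rewrite ltnS in lin.
rewrite mulrA; congr (_ * _).
have [j en] : exists j, n = (i + j)%N by exists (n - i)%N; rewrite subnKC.
rewrite /g /B; case: j en => [|j] en.
  rewrite addn0 in en; rewrite (@hahn_coef_gt _ _ _ _ _ i.+1) ?en // mulr0 subr0.
  rewrite !(@hahn_coefE _ _ _ _ _ _ 0 _ _ (esym (addn0 _)) erefl erefl) !poch0.
  by ring.
rewrite !(@hahn_coefE _ _ _ _ n i j.+1 _ _ en erefl erefl).
rewrite (@hahn_coefE _ _ _ _ n i.+1 j (a + 1 + i%:R + 1) (- N + i%:R)); last 3 first.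
- by rewrite en addnS.
- by rewrite -natr1; ring.
- by rewrite -natr1; ring.
rewrite (@pochSl _ (a + 1 + i%:R) (a + 1 + i%:R + 1)) //.
rewrite (@pochSl _ (- (N + 1) + i%:R) (- N + i%:R)); last by ring.
rewrite !pochSr !factS !natrM exprSr en.
have f0 := @factr_neq0 R.
by field; rewrite ?nat1r -?natrD ?f0 ?pnatr_eq0 ?addnS.
Qed.
End HahnInArgument.

(** * Spectral equation in the variables y *)

Section Coordinates.

Lemma coord_ord (V : nmodType) p (v : 'rV[V]_p) (k : 'I_p) : coord v k.+1 = v 0 k.
Proof.
rewrite /coord (bigD1 k) //= big1 ?addr0 // => i /andP[/eqP[e]] /eqP[].
exact: val_inj.
Qed.

Lemma coord_out (V : nmodType) p (v : 'rV[V]_p) i :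
  (i == 0%N) || (p < i)%N -> coord v i = 0.
Proof.
move=> h; rewrite /coord big_pred0 // => k; apply/negbTE/eqP => e.
by move: h; rewrite -e /= ltnS leqNgt ltn_ord.
Qed.

Lemma coord_row (V : nmodType) p (f : nat -> V) i :
  coord (\row_(k < p) f k.+1) i = if (0 < i <= p)%N then f i else 0.
Proof.
case: ifP => [|/negbT h]; last first.
  by apply: coord_out; case: i h => // i; rewrite /= -ltnNge.
by case: i => // i /= ip; rewrite (coord_ord _ (Ordinal ip)) mxE.
Qed.

Lemma coordD (V : nmodType) p (u v : 'rV[V]_p) i : coord (u + v) i = coord u i + coord v i.
Proof. by rewrite /coord -big_split /=; apply: eq_bigr => k _; rewrite mxE. Qed.

Lemma coordN (V : zmodType) p (v : 'rV[V]_p) i : coord (- v) i = - coord v i.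
Proof. by rewrite /coord -sumrN; apply: eq_bigr => k _; rewrite mxE. Qed.

Lemma coord_basis (V : pzSemiRingType) p i k :
  coord (basis V p i) k = if (0 < k <= p)%N then (k == i)%:R else 0.
Proof. exact: (coord_row p (fun k => (k == i)%:R)). Qed.

Lemma rowP_coord (V : nmodType) p (u v : 'rV[V]_p) :
  (forall i, (0 < i <= p)%N -> coord u i = coord v i) -> u = v.
Proof.
move=> h; apply/rowP => k; rewrite -!coord_ord; apply: h.
by rewrite /= ltn_ord.
Qed.

Lemma psum0 (V : nmodType) p (v : 'rV[V]_p) : psum v 0 = 0.
Proof. by rewrite /psum big_geq. Qed.

Lemma psumS (V : nmodType) p (v : 'rV[V]_p) k : psum v k.+1 = psum v k + coord v k.+1.
Proof. by rewrite /psum big_nat_recr. Qed.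

Lemma coord_complete (R : realType) p N (y : 'rV[R]_p) i :
  coord (complete N y) i = if i == p.+1 then N - psum y p else coord y i.
Proof.
rewrite (_ : complete N y = \row_(k < p.+1) if k.+1 == p.+1 then N - psum y p else coord y k.+1).
  rewrite (coord_row p.+1 (fun i => if i == p.+1 then N - psum y p else coord y i)).
  case: ifP => [//|h]; case: eqP => [e|ne]; first by rewrite e /= ltnSn in h.
  by rewrite coord_out //; case: i h ne => // i h ne; lia.
by apply/rowP => k; rewrite !mxE.
Qed.

Lemma psum_complete (R : realType) p N (y : 'rV[R]_p) k : (k <= p)%N ->
  psum (complete N y) k = psum y k.
Proof.
move=> kp; rewrite /psum !big_nat; apply: eq_bigr => i ik.
by rewrite coord_complete; case: eqP => // e; lia.
Qed.

Lemma psum_complete_last (R : realType) p N (y : 'rV[R]_p) :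
  psum (complete N y) p.+1 = N.
Proof. by rewrite psumS psum_complete // coord_complete eqxx addrC subrK. Qed.

End Coordinates.

Section ArgumentOperators.
Variables (R : realType) (gam : nat -> R) (nu : nat -> nat).
Implicit Types (z : nat -> R) (j k l m : nat).

(** The same sum as [psum], for sequences indexed by all natural numbers. *)
Definition prefix_sum z k : R := \sum_(1 <= i < k.+1) z i.

Definition up l z : nat -> R := fun i => z i + (i == l)%:R.
Definition down l z : nat -> R := fun i => z i - (i == l)%:R.

(** The factor number k, as a function of X = Y_k and M = Y_(k+1); [nu k] is s_k. *)
Definition hahn_factor k (X M : R) : R :=
  hahn1 (nu k - nu k.-1) (X - (nu k.-1)%:R) (2 * (nu k.-1)%:R + prefix_sum gam k + k%:R - 1)
    (gam k.+1) (M - (nu k.-1)%:R).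

(** It involves z_1, ..., z_j only. *)
Definition hahn_prod j z : R :=
  \prod_(1 <= k < j) hahn_factor k (prefix_sum z k) (prefix_sum z k.+1).

Lemma prefix_sumS z k : prefix_sum z k.+1 = prefix_sum z k + z k.+1.
Proof. by rewrite /prefix_sum big_nat_recr. Qed.

Lemma prefix_sum_up k l z : (0 < l)%N -> prefix_sum (up l z) k = prefix_sum z k + (l <= k)%:R.
Proof.
move=> l0; rewrite /prefix_sum big_split /=; congr (_ + _).
case: leqP => lk; last by rewrite big_nat big1 // => i ik; case: eqP => // e; lia.
rewrite (@big_cat_nat _ _ _ l) ?ltnS //=; last exact: leqW.
rewrite big_nat big1; last by move=> i ik; case: eqP => // e; lia.
rewrite big_ltn ?ltnS // eqxx big_nat big1 ?add0r ?addr0 // => i ik.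
by case: eqP => // e; lia.
Qed.

Lemma up_down l z : up l (down l z) = z.
Proof. by apply: boolp.funext => i; rewrite /up /down subrK. Qed.

Lemma down_up l z : down l (up l z) = z.
Proof. by apply: boolp.funext => i; rewrite /up /down addrK. Qed.

Lemma prefix_sum_down k l z : (0 < l)%N -> prefix_sum (down l z) k = prefix_sum z k - (l <= k)%:R.
Proof. by move=> l0; rewrite -{2}(up_down l z) prefix_sum_up // addrK. Qed.

Lemma hahn_prod_ext j z z' : (forall k, (k <= j)%N -> prefix_sum z k = prefix_sum z' k) ->
  hahn_prod j z = hahn_prod j z'.
Proof.
move=> h; rewrite /hahn_prod !big_nat; apply: eq_bigr => k kj.
by rewrite !h //; lia.
Qed.

Hypothesis nu0 : nu 0 = 0%N.
Hypothesis numono : forall k, (nu k <= nu k.+1)%N.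

Lemma hahn_prodS j z : hahn_prod j.+2 z =
  hahn_prod j.+1 z * hahn_factor j.+1 (prefix_sum z j.+1) (prefix_sum z j.+2).
Proof. by rewrite /hahn_prod big_nat_recr. Qed.

(** Adding the variable z_(j+2) multiplies the product by one factor whose arguments
    X and M both move under the old shifts, while only M moves under the new one;
    the induction step is exactly [hahn1_lower]. *)
Lemma lowering j z :
  \sum_(1 <= l < j.+2) z l * hahn_prod j.+1 (down l z)
  = (prefix_sum z j.+1 - (nu j)%:R) * hahn_prod j.+1 z.
Proof.
elim: j => [|j IH].
  by rewrite /hahn_prod nu0 !big_nat1 !big_geq // /prefix_sum big_nat1 subr0.
rewrite big_nat_recr //=.
set X := prefix_sum z j.+1 - (nu j)%:R; set M := prefix_sum z j.+2 - (nu j)%:R.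
set a := 2 * (nu j)%:R + prefix_sum gam j.+1 + j.+1%:R - 1.
set n := (nu j.+1 - nu j)%N.
have e1 : \sum_(1 <= l < j.+2) z l * hahn_prod j.+2 (down l z)
   = (\sum_(1 <= l < j.+2) z l * hahn_prod j.+1 (down l z))
     * hahn1 n (X - 1) a (gam j.+2) (M - 1).
  rewrite mulr_suml !big_nat; apply: eq_bigr => l lj.
  rewrite hahn_prodS !prefix_sum_down; try lia.
  have -> : (l <= j.+1)%N by lia.
  have -> : (l <= j.+2)%N by lia.
  rewrite /hahn_factor /= -/n -/a mulrA.
  congr (_ * hahn1 _ _ _ _ _); rewrite /X /M; ring.
rewrite e1 IH.
have -> : hahn_prod j.+2 (down j.+2 z)
   = hahn_prod j.+1 z * hahn1 n X a (gam j.+2) (M - 1).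
  rewrite hahn_prodS; congr (_ * _).
    apply: hahn_prod_ext => k kj; rewrite prefix_sum_down //.
    by rewrite (_ : (j.+2 <= k)%N = false) ?subr0 //; lia.
  rewrite /hahn_factor !prefix_sum_down // leqnn ltnn subr0 /= -/n -/a -/X.
  by congr hahn1; rewrite /M; ring.
rewrite hahn_prodS /hahn_factor /= -/n -/a -/X -/M.
have := @hahn1_lower R n X a (gam j.+2) M.
have -> : M - X = z j.+2 by rewrite /M /X (prefix_sumS z j.+1); ring.
have -> : M - n%:R = prefix_sum z j.+2 - (nu j.+1)%:R.
  by rewrite /M /n natrB //; ring.
move=> e; transitivity (hahn_prod j.+1 z * (X * hahn1 n (X - 1) a (gam j.+2) (M - 1)
   + z j.+2 * hahn1 n X a (gam j.+2) (M - 1))); first by ring.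
by rewrite e; ring.
Qed.

(** The counterpart of [lowering], with [hahn1_raise] as the induction step. *)
Lemma raising j z :
  \sum_(1 <= l < j.+2) (z l + gam l + 1) * hahn_prod j.+1 (up l z)
  = (prefix_sum z j.+1 + (nu j)%:R + prefix_sum gam j.+1 + j.+1%:R) * hahn_prod j.+1 z.
Proof.
elim: j => [|j IH].
  by rewrite /hahn_prod nu0 !big_nat1 !big_geq // /prefix_sum !big_nat1 addr0.
rewrite big_nat_recr //=.
set X := prefix_sum z j.+1 - (nu j)%:R; set M := prefix_sum z j.+2 - (nu j)%:R.
set a := 2 * (nu j)%:R + prefix_sum gam j.+1 + j.+1%:R - 1.
set n := (nu j.+1 - nu j)%N.
have e1 : \sum_(1 <= l < j.+2) (z l + gam l + 1) * hahn_prod j.+2 (up l z)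
   = (\sum_(1 <= l < j.+2) (z l + gam l + 1) * hahn_prod j.+1 (up l z))
     * hahn1 n (X + 1) a (gam j.+2) (M + 1).
  rewrite mulr_suml !big_nat; apply: eq_bigr => l lj.
  rewrite hahn_prodS !prefix_sum_up; try lia.
  have -> : (l <= j.+1)%N by lia.
  have -> : (l <= j.+2)%N by lia.
  rewrite /hahn_factor /= -/n -/a mulrA.
  congr (_ * hahn1 _ _ _ _ _); rewrite /X /M; ring.
rewrite e1 IH.
have -> : hahn_prod j.+2 (up j.+2 z)
   = hahn_prod j.+1 z * hahn1 n X a (gam j.+2) (M + 1).
  rewrite hahn_prodS; congr (_ * _).
    apply: hahn_prod_ext => k kj; rewrite prefix_sum_up //.
    by rewrite (_ : (j.+2 <= k)%N = false) ?addr0 //; lia.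
  rewrite /hahn_factor !prefix_sum_up // leqnn ltnn addr0 /= -/n -/a -/X.
  by congr hahn1; rewrite /M; ring.
rewrite hahn_prodS /hahn_factor /= -/n -/a -/X -/M.
have := @hahn1_raise R n X a (gam j.+2) M.
have -> : M - X + gam j.+2 + 1 = z j.+2 + gam j.+2 + 1.
  by rewrite /M /X (prefix_sumS z j.+1); ring.
have -> : X + a + 1 = prefix_sum z j.+1 + (nu j)%:R + prefix_sum gam j.+1 + j.+1%:R.
  by rewrite /X /a; ring.
have -> : M + n%:R + a + gam j.+2 + 2 = prefix_sum z j.+2 + (nu j.+1)%:R + prefix_sum gam j.+2 + j.+2%:R.
  by rewrite /M /n natrB // /a (prefix_sumS gam j.+1) -(natr1 j.+1); ring.
move=> e.
set w := prefix_sum z j.+1 + _ + _ + _ in e *.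
transitivity (hahn_prod j.+1 z * (w * hahn1 n (X + 1) a (gam j.+2) (M + 1)
   + (z j.+2 + gam j.+2 + 1) * hahn1 n X a (gam j.+2) (M + 1))); first by ring.
by rewrite e; ring.
Qed.

(** Applying [raising] to [lowering] evaluates the double sum including l = m in two
    ways: as a product of two eigenvalues, and as the sum over l <> m plus the diagonal
    sum_l (z_l + gamma_l + 1)(z_l + 1).  The difference is the eigenvalue. *)
Lemma casimir j z :
  \sum_(1 <= l < j.+2) \sum_(1 <= m < j.+2 | l != m)
    (z l + gam l + 1) * z m * (hahn_prod j.+1 (down m (up l z)) - hahn_prod j.+1 z)
  = - (nu j)%:R * ((nu j)%:R + j%:R + prefix_sum gam j.+1) * hahn_prod j.+1 z.
Proof.
set P := hahn_prod j.+1; set S := prefix_sum z j.+1.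
have inner l : (0 < l < j.+2)%N ->
  \sum_(1 <= m < j.+2 | l != m) z m * (P (down m (up l z)) - P z)
  = (S + 1 - (nu j)%:R) * P (up l z) - (S + 1) * P z.
  move=> lj; have := lowering j (up l z); rewrite prefix_sum_up; last by lia.
  have -> : (l <= j.+1)%N by lia.
  move=> <-; rewrite -/P.
  have -> : (S + 1) = \sum_(1 <= m < j.+2) up l z m.
    have := @prefix_sum_up j.+1 l z; rewrite /prefix_sum => -> ; last by lia.
    by have -> : (l <= j.+1)%N by lia.
  rewrite mulr_suml -sumrB [RHS](bigID (fun m => l != m)) /=.
  rewrite [X in _ = _ + X]big1 ?addr0; last first.
    by move=> m; rewrite negbK => /eqP <-; rewrite down_up subrr.
  apply: eq_bigr => m lm; rewrite /up; rewrite eq_sym in lm.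
  by rewrite (negbTE lm) addr0; ring.
rewrite (eq_big_nat _ _ (F2 := fun l =>
    (S + 1 - (nu j)%:R) * ((z l + gam l + 1) * P (up l z)) - (S + 1) * P z * (z l + gam l + 1))).
  rewrite sumrB -!mulr_sumr raising -/P -/S.
  have -> : \sum_(1 <= i < j.+2) (z i + gam i + 1) = S + prefix_sum gam j.+1 + j.+1%:R.
    by rewrite !big_split /= sumr_const_nat subn1.
  by rewrite -natr1; ring.
move=> l lj.
transitivity ((z l + gam l + 1) * \sum_(1 <= m < j.+2 | l != m) z m * (P (down m (up l z)) - P z)).
  by rewrite mulr_sumr; apply: eq_bigr => m _; rewrite mulrA.
by rewrite inner //; ring.
Qed.
End ArgumentOperators.

(** Since y_(p+1) = N - |y|, shifting y along the zero vector for l = p + 1 still moves the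
    completed component correctly. *)
Lemma coord_complete_shift (R : realType) p N (y : 'rV[R]_p) l m :
  (0 < l <= p.+1)%N -> (0 < m <= p.+1)%N ->
  coord (complete N (y + basis R p l - basis R p m))
  = down m (up l (coord (complete N y))).
Proof.
move=> lp mp; apply: boolp.funext => i.
have yE k : coord (y + basis R p l - basis R p m) k =
    coord y k + (if (0 < k <= p)%N then (k == l)%:R else 0)
     - (if (0 < k <= p)%N then (k == m)%:R else 0).
  by rewrite coordD coordN coordD !coord_basis.
have sE q : (0 < q)%N ->
   \sum_(1 <= k < p.+1) (if (0 < k <= p)%N then (k == q)%:R else 0) = (q <= p)%:R :> R.
  move=> q0; have := @prefix_sum_up R p q (fun _ => 0) q0.
  rewrite /prefix_sum [X in _ = X + _]big1 // add0r => <-.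
  by rewrite !big_nat; apply: eq_bigr => k kp; rewrite /up add0r ifT //; lia.
rewrite /down /up !coord_complete yE.
case: (eqVneq i p.+1) => [->|ne].
  have -> : psum (y + basis R p l - basis R p m) p = psum y p + (l <= p)%:R - (m <= p)%:R.
    rewrite /psum (eq_bigr _ (fun k _ => yE k)) sumrB big_split /= !sE //; lia.
  have -> : (p.+1 == l)%:R = 1 - (l <= p)%:R :> R.
    by case: (leqP l p) => h; case: eqP => e; rewrite ?subrr ?subr0 //; lia.
  have -> : (p.+1 == m)%:R = 1 - (m <= p)%:R :> R.
    by case: (leqP m p) => h; case: eqP => e; rewrite ?subrr ?subr0 //; lia.
  by ring.
case: ifP => // h; have -> : (i == l) = false by lia.
by have -> : (i == m) = false by lia.
Qed.

Lemma psum_nat_mono p (n : 'rV[nat]_p) k : (psum n k <= psum n k.+1)%N.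
Proof. by rewrite psumS leq_addr. Qed.

Lemma hahnE (R : realType) p (n : 'rV[nat]_p) (y : 'rV[R]_p) (gamma : 'rV[R]_p.+1) N :
  hahn n y gamma N =
  (-1) ^+ psum n p / (poch (- N) (psum n p) * hahn_gamma_den gamma n)
  * hahn_prod (coord gamma) (psum n) p.+1 (coord (complete N y)).
Proof.
rewrite /hahn; congr (_ * _); rewrite /hahn_prod !big_nat; apply: eq_bigr => k kp.
rewrite /hahn_factor; congr hahn1.
by case: k kp => // k kp; rewrite psumS addKn.
Qed.

(** The operator preserves Y_k for k > j, so only the first j factors are affected. *)
Lemma argument_spectral (R : realType) p (gamma : 'rV[R]_p.+1) N (y : 'rV[R]_p)
    (n : 'rV[nat]_p) j : (j <= p)%N ->
  Ly j gamma N (fun z => hahn n z gamma N) y = mu j gamma n * hahn n y gamma N.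
Proof.
move=> jp; rewrite /Ly hahnE; set z := coord (complete N y).
set K := _ / _; set P := hahn_prod (coord gamma) (psum n).
pose rest := \prod_(j.+1 <= k < p.+1)
   hahn_factor (coord gamma) (psum n) k (prefix_sum z k) (prefix_sum z k.+1).
have split_prod l m : (0 < l <= j.+1)%N -> (0 < m <= j.+1)%N ->
  P p.+1 (down m (up l z)) = P j.+1 (down m (up l z)) * rest.
  move=> lj mj; rewrite /P /hahn_prod (@big_cat_nat _ _ _ j.+1) //=.
  congr (_ * _); rewrite /rest !big_nat; apply: eq_bigr => k kp.
  rewrite !prefix_sum_down ?prefix_sum_up; try lia.
  have -> : (l <= k)%N by lia. have -> : (m <= k)%N by lia.
  have -> : (l <= k.+1)%N by lia. have -> : (m <= k.+1)%N by lia.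
  by rewrite !addrK.
have split_prod0 : P p.+1 z = P j.+1 z * rest.
  by rewrite -{1 2}(down_up 1 z) split_prod.
transitivity (K * rest * \sum_(1 <= l < j.+2) \sum_(1 <= m < j.+2 | l != m)
    (z l + coord gamma l + 1) * z m * (P j.+1 (down m (up l z)) - P j.+1 z)).
  rewrite mulr_sumr !big_nat; apply: eq_bigr => l lj.
  rewrite mulr_sumr big_nat_cond [RHS]big_nat_cond; apply: eq_bigr => m /andP[mj _].
  rewrite hahnE coord_complete_shift; try lia.
  rewrite -/z -/P -/K split_prod ?split_prod0; try lia.
  by ring.
rewrite casimir; last 2 first.
- exact: psum0.
- by move=> k; apply: psum_nat_mono.
by rewrite split_prod0 /mu -/P /prefix_sum /psum; ring.
Qed.

(** * Transfer form of a sum over chains of nodes *)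

Section Words.
Variable R : comNzRingType.
Notation sign := (option bool).
Implicit Types (w : seq sign) (k m : nat).

(** A word of length m records one element of {-1, 0, 1} for each of m consecutive
    partial sums; the letter 0 is None, and 1, -1 are Some true, Some false. *)
Fixpoint words m : seq (seq sign) :=
  if m is m'.+1 then
    [seq None :: w | w <- words m'] ++ [seq Some true :: w | w <- words m']
    ++ [seq Some false :: w | w <- words m']
  else [:: [::]].

Lemma mem_words m w : (w \in words m) = (size w == m).
Proof.
have inj (a : sign) : injective (cons a) by move=> u v [].
elim: m w => [|m IH] [|a w] //=.
- by rewrite !mem_cat; apply/negbTE; rewrite !negb_or; apply/and3P;
    split; apply/negP => /mapP[].
rewrite !mem_cat eqSS -IH; apply/idP/idP.
  by case/or3P => /mapP[v vm [_ ->]].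
move=> wm; case: a => [[]|]; rewrite (mem_map (inj _)) wm ?orbT //.
Qed.

Lemma uniq_words m : uniq (words m).
Proof.
have inj (a : sign) : injective (cons a) by move=> u v [].
elim: m => //= m IH; rewrite !cat_uniq !(map_inj_uniq (inj _)) IH /= andbT.
apply/andP; split; apply/hasPn => w; rewrite ?mem_cat.
  by case/orP => /mapP[v _ ->]; apply/negP => /mapP[].
by move=> /mapP[v _ ->]; apply/negP => /mapP[].
Qed.

Lemma sum_wordsS m (f : seq sign -> R) :
  \sum_(w <- words m.+1) f w = \sum_(w <- words m)
    (f (None :: w) + f (Some true :: w) + f (Some false :: w)).
Proof. by rewrite /= !big_cat /= !big_map !big_split /= addrA. Qed.

Definition hd w : sign := head None w.

(** The letters sit at the positions k, k - 1, ..., and the position below the last one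
    carries the letter 0: the lower boundary is not shifted. *)
Fixpoint wprod (f : nat -> sign -> sign -> R) w k : R :=
  if w is a :: w' then f k a (hd w') * wprod f w' k.-1 else 1.

(** The iterated difference attached to a word: both E - 1 and E^(-1) - 1 subtract the
    value at the unshifted letter. *)
Fixpoint word_diff w (Phi : seq sign -> R) : R :=
  match w with
  | [::] => Phi [::]
  | None :: w' => word_diff w' (fun u => Phi (None :: u))
  | a :: w' => word_diff w' (fun u => Phi (a :: u)) - word_diff w' (fun u => Phi (None :: u))
  end.

End Words.

Section Transfer.
Variables (R : realType) (s g : nat -> R).
Notation sign := (option bool).
Implicit Types (w : seq sign) (k m : nat) (x : R).

(** Quadratic in the position x of the preceding node.  The nonzero letters give the
    factors between two chosen nodes, the letter 0 gives the factor at the lower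
    boundary.  The last one vanishes at both positions of the node k, and each of the
    others vanishes at one of them. *)
Definition link (a : sign) k x : R :=
  match a with
  | Some true => (s k + x) * (s k + x + 1)
  | Some false => (x - s k - g k) * (x - s k - g k + 1)
  | None => (s k + x) * (s k + g k - x)
  end.

(** The position of a chosen node; the sign -1 reflects s_k to - s_k - g_k. *)
Definition node (b : bool) k : R := if b then s k + g k else - s k.

Definition node_den (b : bool) k : R :=
  (2 * s k + g k) * (2 * s k + g k + (if b then 1 else - 1)).

(** Coefficient of x^2 in [link]. *)
Definition lead (a : sign) : R := if a is None then -1 else 1.

(** Weight of two neighbouring letters in the factored coefficient of a shift.  For an
    unshifted node it is the scalar by which a quadratic minus its interpolant differs
    from [link None]. *)
Definition transfer k (a a' : sign) : R :=
  if a is Some b then link a' k.-1 (node b k) / node_den b k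
  else link a' k.-1 (node true k) / node_den true k
     + link a' k.-1 (node false k) / node_den false k - lead a'.

Definition regular k : Prop :=
  [/\ 2 * s k + g k != 0, 2 * s k + g k + 1 != 0 & 2 * s k + g k - 1 != 0].

(** Lagrange interpolation at the two positions of the node k, seen through the functional
    [ev]: a quadratic minus its interpolant is a multiple of the nodal polynomial.
    In [ev a k] the functional is applied to [link a k]. *)
Definition interpolates (ev : sign -> nat -> R) k : Prop :=
  forall a, ev a k.-1 - ev (Some true) k * (link a k.-1 (node true k) / node_den true k)
   - ev (Some false) k * (link a k.-1 (node false k) / node_den false k)
   = ev None k * transfer k None a.

Definition ev_at x (a : sign) k : R := link a k x.

(** The functional sending x^2, x, 1 to N + 1/2, -1/2, 0.  It is determined by giving the
    factors with which a chain starts, N - s_k and N + s_k + g_k; its value on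
    [link None] is then the natural weight of the empty chain. *)
Definition ev_start (N : R) (a : sign) k : R :=
  match a with
  | Some true => N - s k
  | Some false => N + s k + g k
  | None => - (N + (1 + g k) / 2)
  end.

Lemma ev_at_interpolates x k : regular k -> interpolates (ev_at x) k.
Proof.
case=> D0 D1 D2 a; rewrite /ev_at /transfer /node_den /node.
by case: a => [[]|] /=; field; rewrite D0 D1 D2.
Qed.

Lemma ev_start_interpolates N k : regular k -> interpolates (ev_start N) k.
Proof.
case=> D0 D1 D2 a; rewrite /ev_start /transfer /node_den /node.
by case: a => [[]|] /=; field; rewrite D0 D1 D2.
Qed.

(** With [ev_start] this is the limit of A_nu / beta_0, read from the largest k downwards;
    letters 0 are skipped. *)
Fixpoint chain (ev : sign -> nat -> R) w k : R :=
  match w with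
  | [::] => ev None k
  | None :: w' => chain ev w' k.-1
  | Some b :: w' => ev (Some b) k / node_den b k * chain (ev_at (node b k)) w' k.-1
  end.

(** At an unshifted node the letters 0, 1, -1 contribute a value of the functional minus its
    interpolant, which [interpolates] turns into a single product. *)
Lemma chain_expand m k ev (Phi : seq sign -> R) :
  (forall i, (k - m < i <= k)%N -> regular i) ->
  (forall i, (k - m < i <= k)%N -> interpolates ev i) -> (m <= k)%N ->
  \sum_(w <- words m) chain ev w k * word_diff w Phi
  = \sum_(w <- words m) ev (hd w) k * wprod transfer w k * Phi w.
Proof.
elim: m k ev Phi => [|m IH] k ev Phi reg int mk.
  by rewrite !big_seq1 /= mulr1.
case: k reg int mk => // k reg int mk.
have regk : forall i, (k - m < i <= k)%N -> regular i.
  by move=> i ik; apply: reg; lia.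
have intk x : forall i, (k - m < i <= k)%N -> interpolates (ev_at x) i.
  by move=> i ik; apply/ev_at_interpolates/regk.
have intev : forall i, (k - m < i <= k)%N -> interpolates ev i.
  by move=> i ik; apply: int; lia.
have IHe Psi := IH k ev Psi regk intev mk.
have IHx x Psi := IH k (ev_at x) Psi regk (intk x) mk.
rewrite !sum_wordsS.
transitivity (\sum_(w <- words m) chain ev w k * word_diff w (fun u => Phi (None :: u))
  + \sum_(b <- [:: true; false]) ev (Some b) k.+1 / node_den b k.+1 *
    (\sum_(w <- words m) chain (ev_at (node b k.+1)) w k * word_diff w (fun u => Phi (Some b :: u))
   - \sum_(w <- words m) chain (ev_at (node b k.+1)) w k * word_diff w (fun u => Phi (None :: u)))).
  rewrite !big_cons big_nil addr0 addrA -!sumrB !mulr_sumr -!big_split /=.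
  by apply: eq_bigr => w _; ring.
rewrite IHe !big_cons big_nil !IHx addr0 addrA -!sumrB !mulr_sumr -!big_split /=.
apply: eq_bigr => w _.
have /(_ (hd w)) e : interpolates ev k.+1 by apply: int; lia.
rewrite /= in e; rewrite mulrA -e /ev_at /=.
by ring.
Qed.
End Transfer.

(** * Summation over shifts, one degree at a time *)

Section Recurrence.
Variables (R : realType) (gam : nat -> R) (nu : nat -> nat) (Y : nat -> R).
Notation sign := (option bool).
Implicit Types (w : seq sign) (k m : nat).

Definition sdeg k : R := (nu k)%:R.
Definition gsum k : R := prefix_sum gam k.+1 + k%:R.

Definition letter_val (a : sign) : int :=
  match a with Some true => 1 | Some false => -1 | None => 0 end.

(** Extension by 0 to negative degrees; it represents the terms with an index outside the
    domain. *)
Definition hahnZ (n : int) (X a b M : R) : R :=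
  if n is Posz m then hahn1 m X a b M else 0.

(** The factor number k after s_k and s_(k-1) have moved by the letters a and a'. *)
Definition factorZ k (a a' : sign) : R :=
  hahnZ (Posz (nu k) + letter_val a - (Posz (nu k.-1) + letter_val a'))
    (Y k - (sdeg k.-1 + (letter_val a')%:~R))
    (2 * (sdeg k.-1 + (letter_val a')%:~R) + gsum k.-1) (gam k.+1)
    (Y k.+1 - (sdeg k.-1 + (letter_val a')%:~R)).

(** The weight with which the product over k starts.  Up to normalization it is
    [ev_start] with y in place of N. *)
Definition psi (y : R) (a : sign) k : R :=
  match a with
  | Some true => 1
  | Some false => (y + sdeg k + gsum k) * (y - sdeg k + 1)
  | None => - (y + (1 + gsum k) / 2)
  end.

(** [transfer] multiplied by (c)_n / (c)_m, where c = gamma_(k+1) + 1 and n, m are the degrees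
    of the factor before and after the shift; no denominators in c remain. *)
Definition reduced k (a a' : sign) : R :=
  let n := sdeg k - sdeg k.-1 in
  let A := sdeg k + sdeg k.-1 + gsum k.-1 in
  let B := sdeg k + sdeg k.-1 + gsum k in
  let c := gam k.+1 + 1 in
  let D := 2 * sdeg k + gsum k in
  match a', a with
  | Some true, Some true => B * (B + 1) / (D * (D + 1))
  | Some true, None => - (2 * n * B * (n + c - 1) / ((D + 1) * (D - 1)))
  | Some true, Some false => n * (n - 1) * (n + c - 1) * (n + c - 2) / (D * (D - 1))
  | None, Some true => - B / (D * (D + 1))
  | None, None => 1 - B * (n + c) / (D * (D + 1)) - n * A / (D * (D - 1))
  | None, Some false => - (n * A * (n + c - 1) / (D * (D - 1)))
  | Some false, Some true => 1 / (D * (D + 1))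
  | Some false, None => - (2 * A / ((D + 1) * (D - 1)))
  | Some false, Some false => A * (A - 1) / (D * (D - 1))
  end.

Hypothesis numono : forall k, (nu k <= nu k.+1)%N.

Lemma hahnZ_pred n (X a b M : R) :
  n%:R * hahnZ (Posz n - 1) X a b M = n%:R * hahn1 n.-1 X a b M.
Proof.
case: n => [|n]; first by rewrite mulr0n !mul0r.
by rewrite (_ : Posz n.+1 - 1 = Posz n) //; lia.
Qed.

Lemma hahnZ_pred2 n (X a b M : R) :
  n%:R * (n%:R - 1) * hahnZ (Posz n - 2) X a b M
  = n%:R * (n%:R - 1) * hahn1 n.-2 X a b M.
Proof.
case: n => [|[|n]]; first by rewrite mulr0n !mul0r.
  by rewrite mulr1n subrr !(mulr0, mul0r).
by rewrite (_ : Posz n.+2 - 2 = Posz n) //; lia.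
Qed.

Lemma gsumS k : gsum k.+1 = gsum k + gam k.+2 + 1.
Proof. by rewrite /gsum (prefix_sumS gam k.+1) -natr1; ring. Qed.

(** For a prescribed shift of s_(k-1), summing over the three shifts of s_k is one of the
    contiguity relations of the k-th factor.  The weight psi moves down by one position. *)
Lemma word_step k a' : (0 < k)%N -> regular sdeg gsum k ->
  \sum_(a <- [:: None; Some true; Some false])
    psi (Y k.+1) a k * reduced k a a' * factorZ k a a'
  = psi (Y k) a' k.-1 * factorZ k None None.
Proof.
case: k => // k _ [D0 D1 D2]; rewrite /= in D0 D1 D2 *.
have [n en] : exists n, nu k.+1 = (nu k + n)%N.
  by exists (nu k.+1 - nu k)%N; rewrite subnKC.
have eS : sdeg k.+1 = sdeg k + n%:R by rewrite /sdeg en natrD.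
set a := 2 * sdeg k + gsum k; set c := gam k.+2 + 1.
set X := Y k.+1 - sdeg k; set M := Y k.+2 - sdeg k.
have eg : gsum k.+1 = gsum k + c by rewrite gsumS addrA.
set B := sdeg k.+1 + sdeg k + gsum k.+1; set D := 2 * sdeg k.+1 + gsum k.+1.
have eB : B = n%:R + a + c by rewrite /B /a eS eg; ring.
have eD : D = 2 * n%:R + a + c by rewrite /D /a eS eg; ring.
have ez z z' : Posz (nu k.+1) + z - (Posz (nu k) + z') = Posz n + (z - z').
  by rewrite en PoszD; ring.
have ec : gam k.+2 = c - 1 by rewrite /c addrK.
have eA : sdeg k.+1 + sdeg k + gsum k = n%:R + a by rewrite /a eS; ring.
have ei : sdeg k.+1 - sdeg k = n%:R by rewrite eS; ring.
have ep : (Y k.+2 + sdeg k.+1 + gsum k.+1) * (Y k.+2 - sdeg k.+1 + 1)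
   = (M + B) * (M - n%:R + 1) by rewrite /M /B eS; ring.
have e0 : - (Y k.+2 + (1 + gsum k.+1) / 2) = - (M + (1 + a + c) / 2).
  by rewrite /M /a eg; field.
rewrite !big_cons big_nil addr0 /psi ep e0.
have e1 : factorZ k.+1 None None = hahn1 n X a (c - 1) M.
  by rewrite /factorZ /= ez subrr !addr0 ec.
rewrite e1 /reduced /= -/B -/D ei eA -/c.
case: a' => [[]|].
- rewrite mul1r mul1r -(@contig_plus R n X a c M B D eB eD D0 D1 D2).
  have -> : factorZ k.+1 None (Some true)
     = hahnZ (Posz n - 1) (X - 1) (a + 2) (c - 1) (M - 1).
    by rewrite /factorZ /= ez ec sub0r; congr hahnZ; rewrite /X /a /M; ring.
  have -> : factorZ k.+1 (Some false) (Some true)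
     = hahnZ (Posz n - 2) (X - 1) (a + 2) (c - 1) (M - 1).
    by rewrite /factorZ /= ez ec; congr hahnZ; rewrite /X /a /M; ring.
  have -> : factorZ k.+1 (Some true) (Some true)
     = hahn1 n (X - 1) (a + 2) (c - 1) (M - 1).
    rewrite /factorZ /= ez ec subrr addr0.
    by congr hahn1; rewrite /X /a /M; ring.
  by rewrite -hahnZ_pred -hahnZ_pred2; ring.
- have -> : (Y k.+1 + sdeg k + gsum k) * (Y k.+1 - sdeg k + 1) = (X + a) * (X + 1).
    by rewrite /X /a; ring.
  rewrite -(@contig_minus R n X a c M B D eB eD D0 D1 D2).
  have -> : factorZ k.+1 None (Some false)
     = hahn1 n.+1 (X + 1) (a - 2) (c - 1) (M + 1).
    rewrite /factorZ /= ez ec sub0r opprK (_ : Posz n + 1 = n.+1); last by lia.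
    by congr hahn1; rewrite /X /a /M; ring.
  have -> : factorZ k.+1 (Some false) (Some false)
     = hahn1 n (X + 1) (a - 2) (c - 1) (M + 1).
    rewrite /factorZ /= ez ec subrr addr0.
    by congr hahn1; rewrite /X /a /M; ring.
  have -> : factorZ k.+1 (Some true) (Some false)
     = hahn1 n.+2 (X + 1) (a - 2) (c - 1) (M + 1).
    rewrite /factorZ /= ez ec (_ : Posz n + (1 - -1) = n.+2); last by lia.
    by congr hahn1; rewrite /X /a /M; ring.
  by ring.
- have -> : - (Y k.+1 + (1 + gsum k) / 2) = - (X + (1 + a) / 2).
    by rewrite /X /a; field.
  rewrite -(@contig_zero R n X a c M B D eB eD D0 D1 D2).
  have -> : factorZ k.+1 (Some false) None = hahnZ (Posz n - 1) X a (c - 1) M.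
    by rewrite /factorZ /= ez ec subr0 !addr0.
  have -> : factorZ k.+1 (Some true) None = hahn1 n.+1 X a (c - 1) M.
    by rewrite /factorZ /= ez ec subr0 !addr0 (_ : Posz n + 1 = n.+1) //; lia.
  by rewrite e1 -hahnZ_pred; ring.
Qed.

(** Summing over the first letter with [word_step] replaces the start weight by that of the
    next position and leaves a word shorter by one. *)
Lemma word_sum m k : (m <= k)%N ->
  (forall i, (k - m < i <= k)%N -> regular sdeg gsum i) ->
  \sum_(w <- words m) psi (Y k.+1) (hd w) k * wprod reduced w k * wprod factorZ w k
  = psi (Y (k - m).+1) None (k - m) * wprod factorZ (nseq m None) k.
Proof.
elim: m k => [|m IH] k mk reg; first by rewrite big_seq1 /= subn0 !mulr1.
case: k mk reg => // k mk reg; rewrite sum_wordsS.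
transitivity (\sum_(w <- words m) psi (Y k.+1) (hd w) k * factorZ k.+1 None None
    * wprod reduced w k * wprod factorZ w k).
  apply: eq_bigr => w _ /=.
  rewrite -(@word_step k.+1 (hd w)) //; last by apply: reg; lia.
  by rewrite !big_cons big_nil /psi; ring.
transitivity (factorZ k.+1 None None * \sum_(w <- words m)
    psi (Y k.+1) (hd w) k * wprod reduced w k * wprod factorZ w k).
  by rewrite mulr_sumr; apply: eq_bigr => w _; ring.
rewrite IH //; last by move=> i ik; apply: reg; lia.
have -> : wprod factorZ (nseq m.+1 None) k.+1
   = factorZ k.+1 None None * wprod factorZ (nseq m None) k.
  by rewrite /=; case: (m).
by rewrite subSS; ring.
Qed.

(** The quotient of the two Pochhammer symbols appears as a factor of [transfer], in the
    numerator or cancelled against it; this is where the sums over the unshifted letters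
    are needed in closed form. *)
Lemma reduced_transfer k a a' (m : int) : (0 < k)%N -> regular sdeg gsum k ->
  let c := gam k.+1 + 1 in let n := (nu k - nu k.-1)%N in
  m = Posz n + letter_val a - letter_val a' ->
  0 <= m -> poch c n != 0 -> poch c `|m|%N != 0 ->
  transfer sdeg gsum k a a' / poch c `|m|%N = reduced k a a' / poch c n.
Proof.
case: k => // k _ [D0 D1 D2] c n em; rewrite /= in n D0 D1 D2 em *.
have en : sdeg k.+1 = sdeg k + n%:R by rewrite /sdeg -natrD subnKC.
have eg : gsum k.+1 = gsum k + c by rewrite gsumS addrA.
rewrite /transfer /reduced /node_den /node /link /lead -/c.
rewrite eg en in D0 D1 D2 *; move: em; clearbody n.
have N2 (q : nat) : 2 + q%:R = q.+2%:R :> R by rewrite -natrD.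
case: a => [[]|]; case: a' => [[]|]; rewrite /letter_val => em.
- have {em} -> : m = n by rewrite em; lia.
  move=> _ c0 _ /=; by field; rewrite ?natr1 ?nat1r ?N2 ?c0 ?D0 ?D1.
- have {em} -> : m = n.+2 by rewrite em; lia.
  rewrite /= !pochSr => _ c0; rewrite !mulf_eq0 !negb_or => /andP[/andP[_ c1] c2].
  by field; rewrite ?natr1 ?nat1r ?N2 ?c0 ?c1 ?c2 ?D0 ?D1.
- have {em} -> : m = n.+1 by rewrite em; lia.
  rewrite /= !pochSr => _ c0; rewrite !mulf_eq0 !negb_or => /andP[_ c1].
  by field; rewrite ?natr1 ?nat1r ?N2 ?c0 ?c1 ?D0 ?D1.
- case: n en em D0 D1 D2 => [|[|q]] en em D0 D1 D2; try (by rewrite em).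
  have {em} -> : m = q by rewrite em; lia.
  rewrite /= !pochSr !mulf_eq0 !negb_or => _ /andP[/andP[c0 c1] c2] _ /=.
  by field; rewrite ?natr1 ?nat1r ?N2 ?c0 ?c1 ?c2 ?D0 ?D2.
- have {em} -> : m = n by rewrite em; lia.
  move=> _ c0 _ /=; by field; rewrite ?natr1 ?nat1r ?N2 ?c0 ?D0 ?D2.
- case: n en em D0 D1 D2 => [|q] en em D0 D1 D2; try (by rewrite em).
  have {em} -> : m = q by rewrite em; lia.
  rewrite /= !pochSr !mulf_eq0 !negb_or => _ /andP[c0 c1] _ /=.
  by field; rewrite ?natr1 ?nat1r ?N2 ?c0 ?c1 ?D0 ?D2.
- case: n en em D0 D1 D2 => [|q] en em D0 D1 D2; try (by rewrite em).
  have {em} -> : m = q by rewrite em; lia.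
  rewrite /= !pochSr !mulf_eq0 !negb_or => _ /andP[c0 c1] _ /=.
  by field; rewrite ?natr1 ?nat1r ?N2 ?c0 ?c1 ?D0 ?D1 ?D2.
- have {em} -> : m = n.+1 by rewrite em; lia.
  rewrite /= !pochSr => _ c0; rewrite !mulf_eq0 !negb_or => /andP[_ c1].
  by field; rewrite ?natr1 ?nat1r ?N2 ?c0 ?c1 ?D0 ?D1 ?D2.
- have {em} -> : m = n by rewrite em; lia.
  move=> _ c0 _ /=; by field; rewrite ?natr1 ?nat1r ?N2 ?c0 ?D0 ?D1 ?D2.
Qed.
End Recurrence.

(** * Difference operators acting on functions of the shift *)

Section DifferenceAction.
Variables (R : realType) (q : nat).
Implicit Types (L : diffop R q) (x : 'rV[R]_q) (Psi : 'rV[int]_q -> R) (i : 'I_q).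
Variables (beta : nat -> R) (M : R).
Notation sign := (option bool).

(** The operator applied to a function of the shift alone.  Indicator functions recover the
    coefficients of the operator. *)
Definition dop_act L x Psi : R := \sum_(t <- L) t.1 x beta M * Psi t.2.

Lemma dop_act_comp L1 L2 x Psi : dop_act (dop_comp L1 L2) x Psi =
  \sum_(t <- L1) t.1 x beta M *
     dop_act L2 (x + map_mx intr t.2) (fun v => Psi (t.2 + v)).
Proof.
rewrite /dop_act /dop_comp big_allpairs_dep /=; apply: eq_bigr => t _.
by rewrite mulr_sumr; apply: eq_bigr => u _; rewrite mulrA.
Qed.

Definition fwd i Psi : 'rV[int]_q -> R := fun v => Psi (v + delta_mx 0 i) - Psi v.
Definition bwd i Psi : 'rV[int]_q -> R := fun v => Psi v - Psi (v - delta_mx 0 i).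

Lemma dop_act_delta (s : seq 'I_q) x Psi v :
  dop_act (dop_prod [seq dop_delta R i | i <- s]) x (fun u => Psi (v + u))
  = foldr fwd Psi s v.
Proof.
elim: s x v => [|i s IH] x v /=; first by rewrite /dop_act big_seq1 /= mul1r addr0.
rewrite dop_act_comp /dop_delta !big_cons big_nil /= mul1r mulN1r addr0.
rewrite /fwd -(IH (x + map_mx intr (delta_mx 0 i)) (v + _)).
rewrite -(IH (x + map_mx intr 0) v).
by congr (_ - _); apply: eq_bigr => t _; rewrite ?add0r ?addrA.
Qed.

Lemma dop_act_nabla (s : seq 'I_q) x Psi v :
  dop_act (dop_prod [seq dop_nabla R i | i <- s]) x (fun u => Psi (v + u))
  = foldr bwd Psi s v.
Proof.
elim: s x v => [|i s IH] x v /=; first by rewrite /dop_act big_seq1 /= mul1r addr0.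
rewrite dop_act_comp /dop_nabla !big_cons big_nil /= mul1r mulN1r addr0.
rewrite /bwd -(IH (x + map_mx intr (- delta_mx 0 i)) (v - _)).
rewrite -(IH (x + map_mx intr 0) v).
by congr (_ - _); apply: eq_bigr => t _; rewrite ?add0r ?addrA.
Qed.

Lemma dop_act_Lterm (P Q : {set 'I_q}) x Psi :
  dop_act (Lterm R P Q) x Psi = (-1) ^+ #|Q| * Isub Q (Acoef (P :|: Q)) x beta M
    * foldr fwd (foldr bwd Psi (enum Q)) (enum P) 0.
Proof.
rewrite /Lterm dop_act_comp big_seq1 /=; congr (_ * _).
rewrite dop_act_comp.
have := dop_act_delta (enum P) (x + map_mx intr 0) (foldr bwd Psi (enum Q)) 0.
rewrite /dop_act => <-; apply: eq_bigr => t _; congr (_ * _); rewrite add0r.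
rewrite -(dop_act_nabla (enum Q) (x + map_mx intr 0 + map_mx intr t.2)).
by apply: eq_bigr => u _; rewrite add0r.
Qed.

Lemma foldr_fwd_bwd (s : seq 'I_q) i Psi v :
  foldr fwd (bwd i Psi) s v = foldr fwd Psi s v - foldr fwd Psi s (v - delta_mx 0 i).
Proof.
elim: s v => [|k s IH] v //=; rewrite /fwd !IH (addrAC v (delta_mx 0 k)); ring.
Qed.

Definition letter (P Q : {set 'I_q}) i : sign :=
  if i \in P then Some true else if i \in Q then Some false else None.

Fixpoint wshift (s : seq 'I_q) (w : seq sign) : 'rV[int]_q :=
  match s, w with
  | i :: s', a :: w' => letter_val a *: delta_mx 0 i + wshift s' w'
  | _, _ => 0
  end.

Lemma word_diff_ext (w : seq sign) (F G : seq sign -> R) : F =1 G -> word_diff w F = word_diff w G.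
Proof.
elim: w F G => [|[b|] w IH] F G FG /=; first exact: FG.
  by congr (_ - _); apply: IH => u; apply: FG.
by apply: IH => u; apply: FG.
Qed.

(** The operators commute, so the differences for P and for Q can be sorted by position;
    the sign (-1)^|Q| turns 1 - E^(-1) into E^(-1) - 1. *)
Lemma foldr_word_diff (P Q : {set 'I_q}) (s : seq 'I_q) Psi v : [disjoint P & Q] ->
  (-1) ^+ count (mem Q) s
    * foldr fwd (foldr bwd Psi [seq i <- s | i \in Q]) [seq i <- s | i \in P] v
  = word_diff [seq letter P Q i | i <- s] (fun w => Psi (v + wshift s w)).
Proof.
move=> dPQ; elim: s v => [|i s IH] v /=; first by rewrite mul1r addr0.
case: (boolP (i \in P)) => iP.
  have -> : letter P Q i = Some true by rewrite /letter iP.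
  rewrite (disjointFr dPQ iP) add0n /= /fwd mulrBr !IH.
  by congr (_ - _); apply: word_diff_ext => w; rewrite /= ?scale1r ?scale0r ?add0r ?addrA.
case: (boolP (i \in Q)) => iQ /=.
  have -> : letter P Q i = Some false by rewrite /letter (negbTE iP) iQ.
  rewrite foldr_fwd_bwd exprS mulN1r mulNr mulrBr !IH opprB.
  by congr (_ - _); apply: word_diff_ext => w; rewrite /= ?scaleN1r ?scale0r ?add0r ?addrA.
have -> : letter P Q i = None by rewrite /letter (negbTE iP) (negbTE iQ).
by rewrite IH; apply: word_diff_ext => w; rewrite /= scale0r add0r.
Qed.

Lemma enum_filter (S : {set 'I_q}) : enum S = [seq i <- enum 'I_q | i \in S].
Proof. by rewrite enumT. Qed.

Lemma dop_act_Lgen x Psi :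
  dop_act (Lgen R q) x Psi = \sum_(nu <- signs q)
    Isub nu.2 (Acoef (nu.1 :|: nu.2)) x beta M
    * word_diff [seq letter nu.1 nu.2 i | i <- enum 'I_q]
        (fun w => Psi (wshift (enum 'I_q) w)).
Proof.
rewrite /dop_act /Lgen big_flatten /= big_map !big_seq; apply: eq_bigr => nu.
rewrite mem_enum => /andP[dPQ _].
have := dop_act_Lterm nu.1 nu.2 x Psi; rewrite {1}/dop_act => ->.
rewrite (enum_filter nu.1) (enum_filter nu.2).
rewrite [_ ^+ _ * _]mulrC -mulrA; congr (_ * _).
have -> : #|nu.2| = count (mem nu.2) (enum 'I_q).
  by rewrite cardE enum_filter size_filter.
rewrite foldr_word_diff //; apply: word_diff_ext => w; by rewrite add0r.
Qed.

(** The part of A_nu that follows a chosen node with value z, written recursively. *)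
Fixpoint Atail (xi : nat -> R) (z : R) (l : seq nat) : R :=
  if l is b :: l' then
    (xi b + z + beta b) * (xi b + z + beta b + 1)
    / ((2 * xi b + beta b) * (2 * xi b + beta b + 1)) * Atail xi (xi b) l'
  else (z + beta q.+1 + M) * (M - z).

Lemma Atail_prod (xi : nat -> R) (pos : seq nat) a :
  let X k := xi (nth 0%N (a :: pos) k) in
  let B k := beta (nth 0%N (a :: pos) k) in
  (\prod_(0 <= k < size pos) ((X k.+1 + X k + B k.+1) * (X k.+1 + X k + B k.+1 + 1)))
  / (\prod_(0 <= k < (size pos).+1) ((2 * X k + B k) * (2 * X k + B k + 1)))
  * ((X (size pos) + beta q.+1 + M) * (M - X (size pos)))
  = ((2 * xi a + beta a) * (2 * xi a + beta a + 1))^-1 * Atail xi (xi a) pos.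
Proof.
elim: pos a => [|b pos IH] a /=; first by rewrite big_geq // big_nat1 /= mul1r.
have {IH} := IH b; rewrite /= => e.
rewrite big_nat_recl // [in X in _ / X]big_nat_recl //=.
set F0 := (xi b + xi a + beta b) * _.
set da := (2 * xi a + beta a) * _; set db := (2 * xi b + beta b) * _ in e *.
set P := \prod_(0 <= _ < size pos) _ in e *.
set D := \prod_(0 <= _ < (size pos).+1) _ in e *.
set E := (_ * (M - _)) in e *.
transitivity (F0 / da * (P / D * E)); first by rewrite invfM; ring.
by rewrite e; ring.
Qed.

Lemma Isub_Acoef (P Q : {set 'I_q}) x i0 l :
  let xi k := coord (\row_i (if i \in Q then - x 0 i - beta i.+1 else x 0 i)) k in
  enum (P :|: Q) = i0 :: l ->
  Isub Q (Acoef (P :|: Q)) x beta M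
  = (xi i0.+1 + beta i0.+1 - beta 0%N) * (xi i0.+1 + beta i0.+1)
    / ((2 * xi i0.+1 + beta i0.+1) * (2 * xi i0.+1 + beta i0.+1 + 1))
    * Atail xi (xi i0.+1) [seq (val i).+1 | i <- l].
Proof.
move=> xi el; rewrite /Isub /Acoef el [map _ _]/= -/xi.
have := Atail_prod xi [seq (val i).+1 | i <- l] (val i0).+1.
by rewrite size_map /= => e; rewrite -[RHS]mulrA -e big_add1 /= size_map !mulrA.
Qed.

End DifferenceAction.

(** * Coefficients under the isomorphism b *)

Section Specialization.
Variables (R : realType) (p j : nat) (gamma : 'rV[R]_p.+1) (n : 'rV[nat]_p) (N : R).
Hypothesis jp : (0 < j <= p)%N.
Notation sign := (option bool).
Notation sv := (sdeg R (psum n)).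
Notation gv := (gsum (coord gamma)).
Notation nR := (map_mx (fun m : nat => m%:R : R) n).
Notation bx beta0 := (b_x nR (beta_gamma gamma beta0) N).
Notation bb beta0 := (b_beta p (beta_gamma gamma beta0) N).
Notation bM beta0 := (if j == p then N else coord (bx beta0) j.+1).

Lemma psum_natr k : psum nR k = sv k.
Proof.
rewrite /psum /sdeg /psum natr_sum; apply: eq_bigr => i _.
by rewrite /coord natr_sum; apply: eq_bigr => l _; rewrite mxE.
Qed.

Lemma coord_b_x beta0 k : (k < p)%N ->
  coord (bx beta0) k.+1 = N + (sv (p - k) + gv (p - k)).
Proof.
move=> kp; rewrite (coord_row p (fun k => psum nR (p + 1 - k) +
   beta_gamma gamma beta0 (p + 2 - k) - beta_gamma gamma beta0 0 + N - 1)) /= kp.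
rewrite psum_natr /beta_gamma psum0.
have -> : (p + 1 - k.+1 = p - k)%N by lia.
have -> : (p + 2 - k.+1 = (p - k).+1)%N by lia.
by rewrite /gsum -natr1 /prefix_sum /psum; ring.
Qed.

Lemma b_beta_gammaE beta0 k : (k <= p)%N -> bb beta0 k.+1 = - gv (p - k) - 2 * N.
Proof.
move=> kp; rewrite /b_beta /= /beta_gamma psum0.
have -> : (p + 2 - k.+1 = (p - k).+1)%N by lia.
by rewrite /gsum -natr1 /prefix_sum /psum; ring.
Qed.

Lemma b_beta_gamma0 beta0 : bb beta0 0 = beta0.
Proof. by rewrite /b_beta /= /beta_gamma psum0 !addr0. Qed.

Variables (P Q : {set 'I_j}) (beta0 : R).

Notation x := (resize j (bx beta0)).
Notation xi := (coord (\row_i (if i \in Q then - x 0 i - bb beta0 i.+1 else x 0 i))).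

(** After the substitution and the reflections for Q, the variable of index i is N plus the
    position of the node p - i; beta_0 has cancelled. *)
Lemma reflected_node (i : 'I_j) : xi i.+1 = N + node sv gv (i \notin Q) (p - i).
Proof.
have ip : (i < p)%N by case/andP: jp => _ h; apply: leq_trans h.
rewrite coord_ord mxE mxE coord_b_x // b_beta_gammaE; last exact: ltnW.
by case: (i \in Q); rewrite /node /=; ring.
Qed.

Lemma reflected_den (i : 'I_j) :
  (2 * xi i.+1 + bb beta0 i.+1) * (2 * xi i.+1 + bb beta0 i.+1 + 1)
  = node_den sv gv (i \notin Q) (p - i).
Proof.
have ip : (i < p)%N by case/andP: jp => _ h; apply: leq_trans h.
rewrite reflected_node b_beta_gammaE; last exact: ltnW.
by case: (i \in Q); rewrite /node /node_den /=; ring.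
Qed.

(** For j < p the slot M is the next variable.  For j = p it is N, which corresponds to
    s_0 = 0 because the boundary factor is symmetric under M -> - M - beta. *)
Lemma boundary (z : R) :
  (N + z + bb beta0 j.+1 + bM beta0) * (bM beta0 - (N + z))
  = link sv gv None (p - j) z.
Proof.
case/andP: jp => _ h; rewrite b_beta_gammaE //=; case: eqP => [->|ne].
  by rewrite subnn /sdeg psum0; ring.
by rewrite coord_b_x; [ring | lia].
Qed.

Hypothesis dPQ : [disjoint P & Q].

Lemma letter_in k : k \in P :|: Q -> letter P Q k = Some (k \notin Q).
Proof.
rewrite inE /letter; case: (boolP (k \in P)) => [kP _|_ /= -> //].
by rewrite (disjointFr dPQ kP).
Qed.

Lemma letter_notin k : k \notin P :|: Q -> letter P Q k = None.
Proof. by rewrite inE negb_or /letter => /andP[/negbTE -> /negbTE ->]. Qed.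

Lemma Atail_chain (s : seq 'I_j) i m z :
  [seq val k | k <- s] = iota i m -> (i + m = j)%N ->
  Atail j (bb beta0) (bM beta0) xi (N + z) [seq (val k).+1 | k <- s & k \in P :|: Q]
  = chain sv gv (ev_at sv gv z) [seq letter P Q k | k <- s] (p - i).
Proof.
elim: s i m z => [|k s IH] i [|m] z //=.
  by rewrite addn0 => _ ->; rewrite boundary.
case=> ki es im; have {}ki : nat_of_ord k = i := ki; have {}IH := fun z => IH i.+1 m z es.
have ip : (p - i.+1 = (p - i).-1)%N by lia.
case: (boolP (k \in P :|: Q)) => kPQ; last first.
  by rewrite letter_notin // IH ?ip //; lia.
rewrite letter_in //= reflected_den -ki; congr (_ * _); last first.
  by rewrite reflected_node IH ?ki ?ip //; lia.
have kp : (k < p)%N by case/andP: jp => _ h; apply: leq_trans h.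
congr (_ / _); rewrite reflected_node b_beta_gammaE; last exact: ltnW.
by rewrite /ev_at; case: (k \in Q); rewrite /node /link /=; ring.
Qed.

Lemma chain_start (s : seq 'I_j) i m i0 l :
  [seq val k | k <- s] = iota i m -> (i + m = j)%N ->
  [seq k <- s | k \in P :|: Q] = i0 :: l ->
  - (xi i0.+1 + bb beta0 i0.+1)
    / ((2 * xi i0.+1 + bb beta0 i0.+1) * (2 * xi i0.+1 + bb beta0 i0.+1 + 1))
    * Atail j (bb beta0) (bM beta0) xi (xi i0.+1) [seq (val k).+1 | k <- l]
  = chain sv gv (ev_start sv gv N) [seq letter P Q k | k <- s] (p - i).
Proof.
elim: s i m => [|k s IH] i [|m] //=; case=> ki es im; have {}ki : nat_of_ord k = i := ki.
have ip : (p - i.+1 = (p - i).-1)%N by lia.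
case: (boolP (k \in P :|: Q)) => kPQ; last first.
  by move=> e; rewrite letter_notin // (IH i.+1 m) ?ip //; lia.
case=> <- <-; rewrite letter_in //= reflected_den -ki; congr (_ / _ * _); last first.
  by rewrite reflected_node (@Atail_chain s i.+1 m) ?ki ?ip //; lia.
have kp : (k < p)%N by case/andP: jp => _ h; apply: leq_trans h.
rewrite reflected_node b_beta_gammaE; last exact: ltnW.
by case: (k \in Q); rewrite /node /=; ring.
Qed.

(** The factor of A_nu containing beta_0 is beta_0 minus this constant, up to sign. *)
Definition chain_root : R :=
  if enum (P :|: Q) is i0 :: _ then node sv gv (i0 \notin Q) (p - i0) - gv (p - i0) - N
  else 0.

(** The coefficient is affine in beta_0, and its slope is the chain sum. *)
Lemma Isub_Acoef_chain : P :|: Q != finset.set0 ->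
  Isub Q (Acoef (P :|: Q)) x (bb beta0) (bM beta0)
  = (beta0 - chain_root)
    * chain sv gv (ev_start sv gv N) [seq letter P Q k | k <- enum 'I_j] p.
Proof.
rewrite /chain_root; move=> PQ0; case el : (enum (P :|: Q)) => [|i0 l].
  case/set0Pn: PQ0 => k; rewrite -mem_enum el //.
rewrite (Isub_Acoef _ _ _ el) b_beta_gamma0.
have := @chain_start (enum 'I_j) 0 j i0 l (val_enum_ord j) erefl.
rewrite subn0 -enum_filter => /(_ el) <-.
have e : xi i0.+1 + bb beta0 i0.+1 = node sv gv (i0 \notin Q) (p - i0) - gv (p - i0) - N.
  rewrite reflected_node b_beta_gammaE; last by apply: ltnW; case/andP: jp => _ h; apply: leq_trans h.
  by ring.
by rewrite -e; ring.
Qed.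
End Specialization.

(** * Coefficients of the limit operator *)

Section SignsAndWords.
Variables (R : realType).
Notation sign := (option bool).

Definition word_of q (nu : {set 'I_q} * {set 'I_q}) : seq sign :=
  [seq letter nu.1 nu.2 i | i <- enum 'I_q].

Lemma nth_word_of q nu (i : 'I_q) : nth None (word_of nu) i = letter nu.1 nu.2 i.
Proof. by rewrite (nth_map i) ?size_enum_ord // nth_ord_enum. Qed.

Lemma size_word_of q (nu : {set 'I_q} * {set 'I_q}) : size (word_of nu) = q.
Proof. by rewrite size_map size_enum_ord. Qed.

Lemma word_of_inj q (nu nu' : {set 'I_q} * {set 'I_q}) :
  [disjoint nu.1 & nu.2] -> [disjoint nu'.1 & nu'.2] ->
  word_of nu = word_of nu' -> nu = nu'.
Proof.
case: nu nu' => [P Q] [P' Q'] /= d d' e.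
have el i : letter P Q i = letter P' Q' i by rewrite -(nth_word_of (P, Q)) e nth_word_of.
have eP : P = P'.
  apply/setP => i; have := el i; rewrite /letter.
  by do 4! case: ifP => //.
have eQ : Q = Q'.
  apply/setP => i; have := el i; rewrite /letter -eP.
  case: ifP => [iP _|_]; last by do 2! case: ifP => //.
  by rewrite (disjointFr d iP) (disjointFr d') // -eP.
by rewrite eP eQ.
Qed.

Lemma word_of_surj q w : size w = q -> exists2 nu : {set 'I_q} * {set 'I_q},
  [disjoint nu.1 & nu.2] & word_of nu = w.
Proof.
move=> sw; pose P := [set i : 'I_q | nth None w i == Some true].
pose Q := [set i : 'I_q | nth None w i == Some false].
exists (P, Q).
  rewrite -setI_eq0; apply/eqP/setP => i; rewrite !inE.
  by case: (nth _ _ _) => [[]|].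
apply: (@eq_from_nth _ None); rewrite size_word_of // => i iq.
rewrite (nth_word_of _ (Ordinal iq)) /letter !inE /=.
by case: (nth _ _ _) => [[]|].
Qed.

Lemma word_of_None q (nu : {set 'I_q} * {set 'I_q}) :
  (word_of nu == nseq q None) = (nu.1 :|: nu.2 == finset.set0).
Proof.
apply/eqP/eqP => e.
  apply/setP => i; rewrite !inE; apply/negbTE/negP => h.
  have := nth_word_of nu i; rewrite e nth_nseq ltn_ord /letter.
  by case: ifP => // h1; move: h; rewrite h1 /= => ->.
apply: (@eq_from_nth _ None); rewrite size_word_of ?size_nseq // => i iq.
rewrite (nth_word_of _ (Ordinal iq)) nth_nseq iq /letter.
have /setP/(_ (Ordinal iq)) := e; rewrite !inE.
by case: (_ \in nu.1) => //=; case: (_ \in nu.2).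
Qed.

(** The pairs (P, Q) correspond to the words with a nonzero letter. *)
Lemma sum_signs q (F : seq sign -> R) :
  \sum_(nu <- signs q) F (word_of nu) = \sum_(w <- words q | w != nseq q None) F w.
Proof.
rewrite -(big_map (@word_of q) xpredT F) -[RHS]big_filter; apply: perm_big.
apply: uniq_perm.
- rewrite map_inj_in_uniq ?enum_uniq // => nu nu'.
  rewrite !mem_enum => /andP[d _] /andP[d' _]; exact: word_of_inj.
- by rewrite filter_uniq // uniq_words.
move=> w; rewrite mem_filter mem_words; apply/mapP/andP.
  case=> nu; rewrite mem_enum => /andP[d nu0] ->.
  by rewrite word_of_None size_word_of.
case=> w0 /eqP/word_of_surj[nu d e]; exists nu => //.
by rewrite mem_enum; apply/andP; split=> //; rewrite -word_of_None e.
Qed.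

(** The shift of n belonging to a word: it moves s_(p-i) by the i-th letter of the word,
    counting from 0. *)
Definition wordshift p j (w : seq sign) : 'rV[int]_p :=
  b_shift (resize p (wshift (enum 'I_j) w)).

Lemma dop_coeff_Ln p j kap (v : 'rV[R]_p) beta N :
  dop_coeff (Ln R p j) kap v beta N =
  dop_act (b_beta p beta N)
      (if j == p then N else coord (b_x v beta N) j.+1)
      (Lgen R j) (resize j (b_x v beta N))
      (fun u => (b_shift (resize p u) == kap)%:R).
Proof.
rewrite /dop_coeff /Ln /b_iso /Lx !big_map big_mkcond /dop_act.
apply: eq_bigr => t _ /=; case: eqP; rewrite ?mulr1 ?mulr0 //.
Qed.

End SignsAndWords.

Section LimitCoefficients.
Local Open Scope classical_set_scope.
Local Open Scope ring_scope.
Variable (R : realType).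
Notation sign := (option bool).

(** The limit in beta_0 keeps the slope of an affine function. *)
Lemma lim_affine_div (S T : R) : lim ((b * S - T) / b @[b --> +oo]) = S.
Proof.
apply/cvg_lim => //.
have h : (S - T * b^-1) @[b --> +oo] --> S.
  rewrite -[X in _ --> X]subr0; apply: cvgB; first exact: cvg_cst.
  rewrite -[X in _ --> X](mulr0 T); apply: cvgM; first exact: cvg_cst.
  by apply/gtr0_cvgV0; [exact: nbhs_pinfty_gt | exact: cvg_id].
apply: cvg_trans h; apply: near_eq_cvg; near=> b.
have b0 : b != 0 by apply: lt0r_neq0; near: b; exact: nbhs_pinfty_gt.
by field.
Unshelve. all: by end_near.
Qed.

Variables (p j : nat) (gamma : 'rV[R]_p.+1) (n : 'rV[nat]_p).
Hypothesis jp : (0 < j <= p)%N.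
Notation sv := (sdeg R (psum n)).
Notation gv := (gsum (coord gamma)).
Hypothesis reg : forall i, (p - j < i <= p)%N -> regular sv gv i.

(** Summing over all words and subtracting the zero word, which is absent from the operator. *)
Lemma Lnt_coeffE (kap : 'rV[int]_p) N :
  Lnt_coeff j kap n gamma N =
  \sum_(w <- words j) ev_start sv gv N (hd w) p * wprod (transfer sv gv) w p
     * (wordshift p j w == kap)%:R
  - ev_start sv gv N None (p - j) * (wordshift p j (nseq j None) == kap)%:R.
Proof.
pose Phi w : R := (wordshift p j w == kap)%:R.
pose root (nu : {set 'I_j} * {set 'I_j}) := chain_root gamma n N nu.1 nu.2.
pose cd w := chain sv gv (ev_start sv gv N) w p * word_diff w Phi.
have dE beta0 : dop_coeff (Ln R p j) kap (map_mx (fun m => m%:R) n)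
     (beta_gamma gamma beta0) N
   = beta0 * (\sum_(nu <- signs j) cd (word_of nu))
     - \sum_(nu <- signs j) root nu * cd (word_of nu).
  rewrite dop_coeff_Ln dop_act_Lgen mulr_sumr -sumrB !big_seq; apply: eq_bigr => nu.
  rewrite mem_enum => /andP[d nu0].
  by rewrite Isub_Acoef_chain // -mulrA -mulrBl.
rewrite /Lnt_coeff (_ : (fun b => _ / b) = (fun b => (b * (\sum_(nu <- signs j) cd (word_of nu))
     - \sum_(nu <- signs j) root nu * cd (word_of nu)) / b)); last first.
  by apply: boolp.funext => b; rewrite dE.
rewrite lim_affine_div sum_signs.
have [j0 jlep] := andP jp.
have := @chain_expand R sv gv j p (ev_start sv gv N) Phi reg.
rewrite (bigID (fun w => w != nseq j None)) /= => e.
(* The zero word contributes the value of [ev_start] at the boundary. *)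
have chain0 k m : (m <= k)%N -> chain sv gv (ev_start sv gv N) (nseq m None) k
   = ev_start sv gv N None (k - m).
  elim: m k => [|m IH] [|k] //= mk; by rewrite IH.
have word_diff_nseq m (F : seq sign -> R) : word_diff (nseq m None) F = F (nseq m None).
  by elim: m F => //= m IH F; rewrite IH.
(* It is the only word missing from the operator. *)
have e0 : \sum_(w <- words j | ~~ (w != nseq j None)) cd w
    = ev_start sv gv N None (p - j) * Phi (nseq j None).
  rewrite (eq_bigl (fun w => w == nseq j None)); last by move=> w; rewrite negbK.
  rewrite big_mkcond (bigD1_seq (nseq j None)) /=; last 2 first.
  - by rewrite mem_words size_nseq.
  - exact: uniq_words.
  rewrite eqxx big1 ?addr0; last by move=> w /negbTE ->.
  by rewrite /cd chain0 // word_diff_nseq.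
rewrite e0 in e; rewrite -e ?addrK //.
by move=> i ik; apply/ev_start_interpolates/reg.
Qed.
End LimitCoefficients.

(** * Shifts of the degrees given by words *)

Section WordShifts.
Notation sign := (option bool).
Implicit Types (w : seq sign).

Lemma coordZ p (a : int) (v : 'rV[int]_p) i : coord (a *: v) i = a * coord v i.
Proof. by rewrite /coord mulr_sumr; apply: eq_bigr => k _; rewrite mxE. Qed.

Lemma psumD (V : nmodType) p (u v : 'rV[V]_p) k : psum (u + v) k = psum u k + psum v k.
Proof. by rewrite /psum -big_split; apply: eq_bigr => i _; rewrite coordD. Qed.

Lemma psumN (V : zmodType) p (v : 'rV[V]_p) k : psum (- v) k = - psum v k.
Proof. by rewrite /psum -sumrN; apply: eq_bigr => i _; rewrite coordN. Qed.

Lemma psumZ p (a : int) (v : 'rV[int]_p) k : psum (a *: v) k = a * psum v k.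
Proof. by rewrite /psum mulr_sumr; apply: eq_bigr => i _; rewrite coordZ. Qed.

Lemma psum_sum (V : nmodType) p (I : Type) (s : seq I) (F : I -> 'rV[V]_p) k :
  psum (\sum_(i <- s) F i) k = \sum_(i <- s) psum (F i) k.
Proof.
elim: s => [|i s IH]; last by rewrite !big_cons psumD IH.
rewrite !big_nil /psum big1 // => i _.
by rewrite /coord big1 // => l _; rewrite mxE.
Qed.

Lemma psum_basis p i k : (k <= p)%N -> psum (basis int p i) k = (0 < i <= k)%N%:R.
Proof.
elim: k => [|k IH] kp; first by rewrite psum0; case: i.
rewrite psumS IH ?(ltnW kp) // coord_basis kp /= -natrD; congr (_%:R).
lia.
Qed.

(** A telescoping sum: E_(x_k) moves one partial sum of degrees and fixes the others. *)
Lemma psum_b_shift p (v : 'rV[int]_p) k : (0 < k <= p)%N ->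
  psum (b_shift v) k = coord v (p + 1 - k).
Proof.
move=> /andP[k0 kp]; rewrite /b_shift psum_sum.
transitivity (\sum_(1 <= i < p.+1) (if i == (p + 1 - k)%N then coord v i else 0)).
  rewrite !big_nat; apply: eq_bigr => i ip.
  rewrite psumZ psumD psumN !psum_basis //.
  have -> : (0 < p + 1 - i <= k)%N = (p + 1 - k <= i)%N by lia.
  have -> : (0 < p + 2 - i <= k)%N = (p + 1 - k < i)%N by lia.
  case: ltngtP => h; rewrite ?subrr ?mulr0 ?subr0 ?mulr1 //.
rewrite -big_mkcond big_nat_cond (big_rem (p + 1 - k)%N) /=; last first.
  by rewrite mem_index_iota; lia.
rewrite eqxx andbT ifT; last by lia.
rewrite big_seq_cond big1 ?addr0 // => i /andP[].
rewrite mem_rem_uniq ?iota_uniq // inE => /andP[ne _] /andP[_ /eqP e].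
by rewrite e eqxx in ne.
Qed.

Lemma wshift_entry q (s : seq 'I_q) w i : uniq s -> size w = size s ->
  wshift s w 0 i = if i \in s then letter_val (nth None w (index i s)) else 0.
Proof.
elim: s w => [|k s IH] [|a w] //=; first by rewrite mxE.
move=> /andP[ks us] [sw]; rewrite !mxE IH // inE eq_sym.
case: (eqVneq k i) => [<-|ne] /=; first by rewrite (negbTE ks) mulr1 addr0.
by rewrite mulr0 add0r.
Qed.

Lemma psum_wordshift p j w k : (j <= p)%N -> size w = j -> (k <= p)%N ->
  psum (wordshift p j w) k = letter_val (nth None w (p - k)).
Proof.
move=> jp sw kp; case: k kp => [|k] kp.
  by rewrite psum0 nth_default // sw subn0.
rewrite /wordshift psum_b_shift // (_ : (p + 1 - k.+1 = (p - k.+1).+1)%N); last by lia.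
rewrite (coord_row p (coord (wshift (enum 'I_j) w))) ifT; last by lia.
case: (ltnP (p - k.+1)%N j) => h; last first.
  by rewrite coord_out // ?nth_default ?sw // ltnS h orbT.
rewrite (coord_ord _ (Ordinal h)) wshift_entry ?enum_uniq ?size_enum_ord //.
by rewrite mem_enum index_enum_ord.
Qed.

Lemma letter_val_inj : injective letter_val.
Proof. by move=> [[]|] [[]|]. Qed.

Lemma wordshift_inj p j w w' : (j <= p)%N -> size w = j -> size w' = j ->
  wordshift p j w = wordshift p j w' -> w = w'.
Proof.
move=> jp sw sw' e; apply: (@eq_from_nth _ None); rewrite ?sw ?sw' // => i ij.
apply: letter_val_inj; rewrite -(@subKn i p); last by lia.
by rewrite -!(@psum_wordshift p j) ?e ?leq_subr.
Qed.

Lemma shifts_comp (R : realType) p (L1 L2 : diffop R p) :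
  [seq t.2 | t <- dop_comp L1 L2]
  = [seq a + b | a <- [seq t.2 | t <- L1], b <- [seq t.2 | t <- L2]].
Proof. by rewrite /dop_comp map_allpairs allpairs_mapl allpairs_mapr. Qed.

Lemma shifts_deltas (R : realType) q (s : seq 'I_q) (c : 'I_q -> bool) :
  \sum_(i <- s) (if c i then delta_mx 0 i else 0)
  \in [seq t.2 | t <- dop_prod [seq dop_delta R i | i <- s]].
Proof.
elim: s => [|i s IH] /=; first by rewrite big_nil inE.
rewrite shifts_comp big_cons; apply: allpairs_f => //.
by case: (c i); rewrite !inE eqxx ?orbT.
Qed.

Lemma shifts_nablas (R : realType) q (s : seq 'I_q) :
  \sum_(i <- s) - delta_mx 0 i
  \in [seq t.2 | t <- dop_prod [seq dop_nabla R i | i <- s]].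
Proof.
elim: s => [|i s IH] /=; first by rewrite big_nil inE.
rewrite shifts_comp big_cons; apply: allpairs_f => //.
by rewrite !inE eqxx orbT.
Qed.

(** A word of shifts occurs in the term whose nu is nonzero everywhere, with -1 where the
    word has -1 and 1 elsewhere. *)
Lemma wordshift_in_shifts (R : realType) p j w : (0 < j)%N -> size w = j ->
  wordshift p j w \in dop_shifts (Ln R p j).
Proof.
move=> j0 sw; rewrite mem_undup /Ln /b_iso /Lx -!map_comp /wordshift.
rewrite (@map_comp _ _ _ (fun u => b_shift (resize p u)) snd).
apply/map_f; rewrite /Lgen map_flatten -map_comp.
(* At a letter 0 or 1 take nu = 1: the difference E - 1 contains both shifts. *)
pose Q := [set i : 'I_j | nth None w i == Some false].
apply/flatten_mapP; exists (~: Q, Q).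
  rewrite mem_enum; apply/andP; split.
    by rewrite -finset.setI_eq0 /= finset.setIC finset.setICr.
  rewrite /= finset.setUC finset.setUCr; apply/eqP => /setP/(_ (Ordinal j0)).
  by rewrite !inE.
rewrite /Lterm /= shifts_comp.
have -> : wshift (enum 'I_j) w = 0 + (\sum_(i <- enum (~: Q))
   (if nth None w i == Some true then delta_mx 0 i else 0)
   + \sum_(i <- enum Q) - delta_mx 0 i).
  rewrite add0r !big_enum /= (big_mkcond (mem (~: Q))) (big_mkcond (mem Q)) -big_split /=.
  apply/rowP => k; rewrite wshift_entry ?enum_uniq ?size_enum_ord // mem_enum.
  rewrite index_enum_ord summxE (bigD1 k) //= big1 ?addr0; last first.
    move=> i ik; have ki : (k == i) = false by rewrite eq_sym (negbTE ik).
    rewrite mxE !inE.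
    by case: (nth _ _ _) => [[]|]; rewrite /= !mxE ?ki ?andbF ?addr0 ?oppr0.
  by rewrite mxE !inE; case: (nth _ _ _) => [[]|]; rewrite /= !mxE ?eqxx ?addr0 ?add0r.
apply: allpairs_f; first by rewrite inE.
rewrite shifts_comp; apply: allpairs_f; first exact: shifts_deltas.
exact: shifts_nablas.
Qed.

(** Distinct words give distinct shifts, so a sum over shifts is a sum over words. *)
Lemma sum_shifts (R : realType) p j (C : pred 'rV[int]_p) (f : 'rV[int]_p -> R) :
  (0 < j <= p)%N ->
  (forall kap, (forall w, w \in words j -> wordshift p j w != kap) -> f kap = 0) ->
  \sum_(kap <- dop_shifts (Ln R p j) | C kap) f kap
  = \sum_(w <- words j | C (wordshift p j w)) f (wordshift p j w).
Proof.
move=> /andP[j0 jp] f0; pose B := [seq wordshift p j w | w <- words j].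
rewrite -(big_map (wordshift p j) C f) -/B.
have uB : uniq B.
  rewrite map_inj_in_uniq ?uniq_words // => w w'; rewrite !mem_words.
  by move=> /eqP sw /eqP sw'; apply: wordshift_inj.
have fB kap : kap \notin B -> f kap = 0.
  move=> kB; apply: f0 => w ww; apply/eqP => e.
  by rewrite -e map_f in kB.
rewrite (bigID (mem B)) /= [X in _ + X]big1 ?addr0; last first.
  by move=> kap /andP[_]; apply: fB.
rewrite -(big_filter _ (fun kap => C kap && (kap \in B))) -[RHS]big_filter.
apply: perm_big; apply: uniq_perm; rewrite ?filter_uniq ?undup_uniq //.
move=> kap; rewrite !mem_filter; case: (C kap) => //=.
case kB : (kap \in B) => //=; move: kB => /mapP[w]; rewrite mem_words => /eqP sw ->.
exact: wordshift_in_shifts.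
Qed.
End WordShifts.

(** * Shifting the factors of the polynomial *)

Section ShiftedProducts.
Variables (R : realType) (gam : nat -> R) (nu nu' : nat -> nat).
Notation sign := (option bool).
Implicit Types (w : seq sign) (k : nat) (z : nat -> R).
Hypothesis nuS : forall k, (nu k <= nu k.+1)%N.
Hypothesis nu'S : forall k, (nu' k <= nu' k.+1)%N.

Lemma hahn_prod_word w k z : (size w <= k)%N ->
  (forall i, (i <= k)%N -> Posz (nu' i) = Posz (nu i) + letter_val (nth None w (k - i))) ->
  hahn_prod gam nu' k.+1 z
  = hahn_prod gam nu (k - size w).+1 z * wprod (factorZ gam nu (prefix_sum z)) w k.
Proof.
elim: w k => [|a w IH] k wk e.
  rewrite /= subn0 mulr1 /hahn_prod !big_nat; apply: eq_bigr => i ik.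
  have eq i' : (i' <= k)%N -> nu' i' = nu i'.
    by move=> h; have := e i' h; rewrite nth_nil addr0 => -[].
  by rewrite /hahn_factor !eq //; lia.
case: k wk e => // k wk e.
have e1 := e k.+1 (leqnn _); rewrite subnn /= in e1.
have e2 := e k (leqnSn k); rewrite subSnn /= in e2.
rewrite hahn_prodS (IH k) //; last first.
  by move=> i ik; rewrite e ?(leqW ik) // subSn.
rewrite /= subSS mulrAC mulrA; congr (_ * _).
rewrite /factorZ /= -e1 -(_ : Posz (nu' k) = Posz (nu k) + letter_val (hd w)); last first.
  by rewrite e2 /hd -nth0.
rewrite subzn // /hahn_factor /=.
have e3 : sdeg R nu k + (letter_val (hd w))%:~R = (nu' k)%:R.
  by rewrite /sdeg -[(nu' k)%:R]/((Posz (nu' k))%:~R) e2 /hd -nth0 intrD.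
rewrite e3; congr (_ * hahn1 _ _ _ _ _); rewrite /gsum -natr1; ring.
Qed.

(** A negative component makes the corresponding factor 0, which agrees with leaving out the
    term. *)
Lemma wprod_factorZ_neq0 (Y : nat -> R) w k : (size w <= k)%N ->
  wprod (factorZ gam nu Y) w k != 0 -> forall i, (0 < i <= k)%N ->
  0 <= Posz (nu i) + letter_val (nth None w (k - i))
       - (Posz (nu i.-1) + letter_val (nth None w (k - i.-1))).
Proof.
elim: w k => [|a w IH] k wk.
  move=> _ [|i] // _; rewrite !nth_nil !addr0 subr_ge0 /=.
  exact: nuS.
case: k wk => // k wk; rewrite /= mulf_eq0 negb_or => /andP[f0 w0] i ik.
case: (ltngtP i k.+1) => h; try lia.
  have := IH k wk w0 i; rewrite subSn; last by lia.
  rewrite (_ : (k.+1 - i.-1 = (k - i.-1).+1)%N); last by lia.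
  by apply; lia.
rewrite h subnn /= subSnn /=; move: f0; rewrite /factorZ /= nth0.
by case: (_ - _) => [m|m] //; rewrite eqxx.
Qed.

Definition gamma_den (mu : nat -> nat) k : R :=
  \prod_(1 <= i < k) poch (gam i.+1 + 1) (mu i - mu i.-1).

Lemma gamma_den_word w k : (size w <= k)%N ->
  (forall i, (i <= k)%N -> Posz (nu' i) = Posz (nu i) + letter_val (nth None w (k - i))) ->
  (forall i, (k - size w < i <= k)%N -> regular (sdeg R nu) (gsum gam) i) ->
  gamma_den nu k.+1 != 0 -> gamma_den nu' k.+1 != 0 ->
  wprod (transfer (sdeg R nu) (gsum gam)) w k / gamma_den nu' k.+1
  = wprod (reduced gam nu) w k / gamma_den nu k.+1.
Proof.
elim: w k => [|a w IH] k wk e reg.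
  move=> _ _; congr (_ / _); rewrite /gamma_den !big_nat; apply: eq_bigr => i ik.
  have eq i' : (i' <= k)%N -> nu' i' = nu i'.
    by move=> h; have := e i' h; rewrite nth_nil addr0 => -[].
  by rewrite !eq //; lia.
case: k wk e reg => // k wk e reg.
have dS mu : gamma_den mu k.+2 = gamma_den mu k.+1 * poch (gam k.+2 + 1) (mu k.+1 - mu k).
  by rewrite /gamma_den big_nat_recr.
rewrite !dS !mulf_eq0 !negb_or => /andP[d0 p0] /andP[d0' p0'].
have e1 := e k.+1 (leqnn _); rewrite subnn /= in e1.
have e2 := e k (leqnSn k); rewrite subSnn /= nth0 in e2.
have {}IH : wprod (transfer (sdeg R nu) (gsum gam)) w k / gamma_den nu' k.+1
  = wprod (reduced gam nu) w k / gamma_den nu k.+1.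
  apply: IH => // [i ik|i ik]; first by rewrite e ?(leqW ik) // subSn.
  by apply: reg; rewrite /=; lia.
have regk : regular (sdeg R nu) (gsum gam) k.+1 by apply: reg; rewrite /=; lia.
have := @reduced_transfer R gam nu nuS k.+1 a (hd w)
   (Posz (nu' k.+1 - nu' k)%N) (ltn0Sn k) regk.
rewrite /= => H; have {}H := H _ isT p0 p0'.
have {}H := H (_ : _ = _).
set t := transfer _ _ _ _ _ in H *; set r := reduced _ _ _ _ _ in H *.
set T := wprod _ _ _ in IH *; set W := wprod (reduced _ _) _ _ in IH *.
rewrite /= -/t -/r -/T -/W.
transitivity ((t / poch (gam k.+2 + 1) (nu' k.+1 - nu' k)) * (T / gamma_den nu' k.+1)).
  by rewrite invfM; ring.
rewrite IH H; first by rewrite invfM; ring.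
by rewrite -!subzn // e1 e2 /hd; ring.
Qed.

(** The first weight contains the quotient of the symbols (-N)_(s_p) before and after the
    shift. *)
Lemma start_word (N : R) (a : sign) k :
  Posz (nu' k) = Posz (nu k) + letter_val a ->
  poch (- N) (nu k) != 0 -> poch (- N) (nu' k) != 0 ->
  ev_start (sdeg R nu) (gsum gam) N a k * ((-1) ^+ nu' k / poch (- N) (nu' k))
  = psi gam nu N a k * ((-1) ^+ nu k / poch (- N) (nu k)).
Proof.
rewrite /sdeg /ev_start /psi /sdeg; case: a => [[]|] /= e.
- have -> : nu' k = (nu k).+1 by lia.
  rewrite pochSr mulf_eq0 negb_or exprSr => p0 /andP[_ p1].
  by field; rewrite p0 p1.
- have -> : nu k = (nu' k).+1 by lia.
  rewrite pochSr mulf_eq0 negb_or exprSr -natr1 => /andP[p0 p1] _.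
  by field; rewrite p0 p1.
- by have -> : nu' k = nu k by move: e; rewrite addr0 => -[].
Qed.

End ShiftedProducts.

(** * Spectral equation in the degrees n *)

Section ShiftedIndices.
Variables (p : nat) (n : 'rV[nat]_p).
Implicit Types (v : 'rV[int]_p) (k : nat).

Lemma psum_shift_index v k : psum (shift_index n v) k = Posz (psum n k) + psum v k.
Proof.
rewrite /shift_index psumD; congr (_ + _).
rewrite /psum (big_morph Posz PoszD (erefl _)); apply: eq_bigr => i _.
by rewrite /coord (big_morph Posz PoszD (erefl _)); apply: eq_bigr => l _; rewrite mxE.
Qed.

Lemma nonneg_indexP v : reflect (forall k, (0 < k <= p)%N -> 0 <= coord v k) (nonneg_index v).
Proof.
apply: (iffP forallP) => h i.
  by case: i => // i ip; rewrite (coord_ord v (Ordinal ip)).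
by rewrite -coord_ord; apply: h; rewrite /= ltn_ord.
Qed.

Lemma psum_nat_index v k : nonneg_index v -> Posz (psum (nat_index v) k) = psum v k.
Proof.
move=> /forallP v0; rewrite /psum (big_morph Posz PoszD (erefl _)); apply: eq_bigr => i _.
rewrite /coord (big_morph Posz PoszD (erefl _)); apply: eq_bigr => l _.
by rewrite mxE gez0_abs // v0.
Qed.

Lemma coord_psum v k : (0 < k)%N -> coord v k = psum v k - psum v k.-1.
Proof. by case: k => // k _; rewrite psumS /= [X in X - _]addrC addrK. Qed.

Lemma hahn_gamma_denE (R : realType) (gamma : 'rV[R]_p.+1) (m : 'rV[nat]_p) :
  hahn_gamma_den gamma m = gamma_den (coord gamma) (psum m) p.+1.
Proof.
rewrite /hahn_gamma_den /gamma_den !big_nat; apply: eq_bigr => k kp.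
by congr poch; case: k kp => // k kp; rewrite psumS addKn.
Qed.
End ShiftedIndices.

Section Limits.
Local Open Scope classical_set_scope.
Local Open Scope ring_scope.
Variables (R : realType).

(** This gives continuity in M. *)
Lemma hahn1_poly n (X a b : R) : exists f : {poly R}, forall M, hahn1 n X a b M = f.[M].
Proof.
exists (\sum_(i < n.+1)
    (poch (- n%:R) i * poch (n%:R + a + b + 1) i * poch (- X) i / (i`!)%:R
    * poch (a + 1 + i%:R) (n - i))
    *: \prod_(k < n - i) (- 'X + i%:R%:P + k%:R%:P)) => M.
rewrite horner_sum; apply: eq_bigr => i _; rewrite hornerZ horner_prod mulrA.
congr (_ * _); apply: eq_bigr => k _.
by rewrite !hornerD hornerN hornerX !hornerC.
Qed.

Lemma horner_cvg_dnbhs (f : {poly R}) (N : R) : f.[M] @[M --> N^'] --> f.[N].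
Proof. by apply: cvg_within_filter; exact: continuous_horner. Qed.

Lemma poch_cvg_dnbhs (N : R) k : poch (- M) k @[M --> N^'] --> poch (- N) k.
Proof.
pose f : {poly R} := \prod_(i < k) (- 'X + i%:R%:P).
have fE M : poch (- M) k = f.[M].
  rewrite horner_prod; apply: eq_bigr => i _.
  by rewrite !hornerD hornerN hornerX !hornerC.
rewrite fE (_ : (fun M => poch (- M) k) = horner f); last exact/boolp.funext.
exact: horner_cvg_dnbhs.
Qed.

Lemma hahn1_shift_cvg n (X a b c N : R) :
  hahn1 n X a b (M - c) @[M --> N^'] --> hahn1 n X a b (N - c).
Proof.
have [f fE] := hahn1_poly n X a b.
have gE M : hahn1 n X a b (M - c) = (f \Po ('X - c%:P)).[M].
  by rewrite fE horner_comp hornerD hornerN hornerX hornerC.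
rewrite gE (_ : (fun M => hahn1 n X a b (M - c)) = horner (f \Po ('X - c%:P)));
  last by apply: boolp.funext => M; rewrite gE.
exact: horner_cvg_dnbhs.
Qed.

Lemma hahn_prod_cvg p (gam : nat -> R) (nu : nat -> nat) (y : 'rV[R]_p) (N : R) :
  hahn_prod gam nu p.+1 (coord (complete M y)) @[M --> N^'] -->
  hahn_prod gam nu p.+1 (coord (complete N y)).
Proof.
case: p y => [|p] y.
  have e M : hahn_prod gam nu 1 (coord (complete M y)) = 1 by rewrite /hahn_prod big_geq.
  rewrite e (_ : (fun M => hahn_prod gam nu 1 (coord (complete M y))) = fun=> 1).
    exact: cvg_cst.
  exact: boolp.funext.
have pE M k : (k <= p.+1)%N -> prefix_sum (coord (complete M y)) k = psum y k.
  exact: psum_complete.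
have hE M : hahn_prod gam nu p.+2 (coord (complete M y))
   = hahn_prod gam nu p.+1 (coord (complete N y)) *
     hahn_factor gam nu p.+1 (psum y p.+1) M.
  rewrite hahn_prodS pE // [prefix_sum _ p.+2]psum_complete_last; congr (_ * _).
  by apply: hahn_prod_ext => k kp; rewrite !pE.
rewrite hE (_ : (fun M => hahn_prod gam nu p.+2 (coord (complete M y)))
    = (fun M => hahn_prod gam nu p.+1 (coord (complete N y)) *
     hahn_factor gam nu p.+1 (psum y p.+1) M)); last by apply: boolp.funext => M; rewrite hE.
by apply: cvgM; [exact: cvg_cst | exact: hahn1_shift_cvg].
Qed.

End Limits.

Section IndexSpectral.
Local Open Scope classical_set_scope.
Local Open Scope ring_scope.
Variables (R : realType) (p j : nat) (gamma : 'rV[R]_p.+1) (N : R) (y : 'rV[R]_p).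
Variable (n : 'rV[nat]_p).
Notation sign := (option bool).
Hypothesis jp : (0 < j <= p)%N.
Hypothesis hn : considered N n.
Hypothesis hden : hahn_gamma_den gamma n != 0.
Hypothesis hden' : forall s : 'rV[int]_p, s \in dop_shifts (Ln R p j) ->
      nonneg_index (shift_index n s) ->
      hahn_gamma_den gamma (nat_index (shift_index n s)) != 0.
Hypothesis hreg : Lnt_den_neq0 j gamma n.
Notation gam := (coord gamma).
Notation sv := (sdeg R (psum n)).
Notation gv := (gsum gam).
Notation Y := (prefix_sum (coord (complete N y))).
Notation shifted w := (nat_index (shift_index n (wordshift p j w))).

Lemma regular_nodes i : (p - j < i <= p)%N -> regular sv gv i.
Proof.
move=> ij; have e : 2 * sv i + gv i = 2 * (psum n i)%:R + psum gamma i.+1 + i%:R.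
  by rewrite /gsum addrA.
have h (c : R) : c \in [:: -1; 0; 1] -> 2 * sv i + gv i + c != 0.
  by move=> cE; rewrite e; apply: hreg => //; lia.
split; [rewrite -[X in X != 0]addr0|..]; apply: h; rewrite !inE eqxx ?orbT //.
Qed.

Lemma poch_prefactor_neq0 s : (forall i, (i < s)%N -> N != i%:R) -> poch (- N) s != 0.
Proof.
move=> h; rewrite /poch prodf_seq_neq0; apply/allP => i _ /=.
by rewrite addrC subr_eq0 eq_sym h.
Qed.

Lemma poch_n_neq0 : poch (- N) (psum n p) != 0.
Proof.
apply: poch_prefactor_neq0 => i ip; apply/eqP => e.
have : (psum n p)%:R <= N by apply: hn; rewrite e natr_nat.
by rewrite e ler_nat leqNgt ip.
Qed.

Lemma psum_shifted w k : size w = j -> nonneg_index (shift_index n (wordshift p j w)) ->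
  (k <= p)%N -> Posz (psum (shifted w) k) = Posz (psum n k) + letter_val (nth None w (p - k)).
Proof.
move=> sw w0 kp; rewrite psum_nat_index // psum_shift_index psum_wordshift //.
by case/andP: jp.
Qed.

Definition word_coeff M (w : seq sign) : R :=
  ev_start sv gv M (hd w) p * wprod (transfer sv gv) w p.

Lemma Lnt_coeff_word M w : w \in words j ->
  Lnt_coeff j (wordshift p j w) n gamma M
  = word_coeff M w - ev_start sv gv M None (p - j) * (w == nseq j None)%:R.
Proof.
move=> ww; rewrite Lnt_coeffE //; last exact: regular_nodes.
have inj u v : u \in words j -> v \in words j ->
    (wordshift p j u == wordshift p j v) = (u == v).
  rewrite !mem_words => /eqP su /eqP sv'; apply/eqP/eqP => [|-> //].
  by apply: wordshift_inj => //; case/andP: jp.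
have wn : nseq j None \in words j by rewrite mem_words size_nseq.
rewrite (inj _ _ wn ww).
rewrite (eq_sym (nseq j None) w); congr (_ - _).
rewrite (bigD1_seq w) ?uniq_words //= eqxx mulr1 big_seq_cond big1 ?addr0 //.
by move=> u /andP[uw ne]; rewrite inj // (negbTE ne) mulr0.
Qed.

Definition prefactor : R := (-1) ^+ psum n p / poch (- N) (psum n p).

(** The term of the operator for the word w, with the start weight already cancelled against
    (-N)_(|n|).  In this form it makes sense at |n| = N. *)
Definition word_term (w : seq sign) : R :=
  psi gam (psum n) N (hd w) p * prefactor * (wprod (transfer sv gv) w p
   / hahn_gamma_den gamma (shifted w))
  * hahn_prod gam (psum (shifted w)) p.+1 (coord (complete N y)).

Lemma hd_nth (w : seq sign) : hd w = nth None w 0.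
Proof. by rewrite nth0. Qed.

Lemma word_term_direct w : size w = j -> nonneg_index (shift_index n (wordshift p j w)) ->
  poch (- N) (psum (shifted w) p) != 0 ->
  word_coeff N w * hahn (shifted w) y gamma N = word_term w.
Proof.
move=> sw w0 pn'; rewrite hahnE /word_coeff /word_term /prefactor.
have := @start_word R gam (psum n) (psum (shifted w)) N (hd w) p.
rewrite (psum_shifted sw w0) // subnn hd_nth => /(_ erefl poch_n_neq0 pn') e.
rewrite -hd_nth in e; rewrite -{}e.
move: (ev_start _ _ _ _ _) (wprod _ _ _) (hahn_prod _ _ _ _) (hahn_gamma_den _ _)
  (poch _ _) ((-1) ^+ psum (shifted w) p) => a b c d e f.
by rewrite invfM; ring.
Qed.

(** Off N the factor N' - |n| of the coefficient cancels the zero of (-N')_(|n|+1) at N; what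
    remains is continuous. *)
Lemma word_term_limit w : size w = j -> nonneg_index (shift_index n (wordshift p j w)) ->
  hd w = Some true -> (psum n p)%:R = N ->
  lim (word_coeff M w * hahn (shifted w) y gamma M @[M --> N^']) = word_term w.
Proof.
move=> sw w0 hw eN; apply/cvg_lim => //.
pose c := (-1) ^+ psum n p * (wprod (transfer sv gv) w p
   / hahn_gamma_den gamma (shifted w)).
have h : c * (poch (- M) (psum n p))^-1
     * hahn_prod gam (psum (shifted w)) p.+1 (coord (complete M y)) @[M --> N^']
     --> word_term w.
  rewrite (_ : word_term w = c * (poch (- N) (psum n p))^-1
     * hahn_prod gam (psum (shifted w)) p.+1 (coord (complete N y))); last first.
    by rewrite /word_term hw /psi /prefactor /c; ring.
  apply: cvgM; last exact: hahn_prod_cvg.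
  apply: cvgM; first exact: cvg_cst.
  by apply: cvgV; [exact: poch_n_neq0 | exact: poch_cvg_dnbhs].
apply: cvg_trans h; apply: near_eq_cvg; near=> M.
have MN : M - N != 0 by rewrite subr_eq0; near: M; exact: nbhs_dnbhs_neq.
have es : psum (shifted w) p = (psum n p).+1.
  have := @psum_shifted w p sw w0 (leqnn p).
  by rewrite subnn -hd_nth hw /= => e; lia.
rewrite hahnE /word_coeff hw /ev_start es pochSr exprSr /c.
rewrite (_ : sv p = N) // eN.
rewrite (_ : - M + N = - (M - N)); last by ring.
rewrite !invfM.
transitivity (((M - N) / (M - N)) * ((-1) ^+ psum n p * (wprod (transfer sv gv) w p
   / hahn_gamma_den gamma (shifted w)) / poch (- M) (psum n p)
     * hahn_prod gam (psum (shifted w)) p.+1 (coord (complete M y)))).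
  by rewrite divff // mul1r.
by rewrite invrN; ring.
Unshelve. all: by end_near.
Qed.

Definition common_factor : R :=
  prefactor / hahn_gamma_den gamma n
  * hahn_prod gam (psum n) (p - j).+1 (coord (complete N y)).

(** The remaining denominators are those of the unshifted index, common to all words. *)
Lemma word_termE w : w \in words j -> nonneg_index (shift_index n (wordshift p j w)) ->
  word_term w = common_factor * (psi gam (psum n) N (hd w) p
    * wprod (reduced gam (psum n)) w p * wprod (factorZ gam (psum n) Y) w p).
Proof.
rewrite mem_words => /eqP sw w0; have [j0 jlep] := andP jp.
have e i : (i <= p)%N -> Posz (psum (shifted w) i) = Posz (psum n i) + letter_val (nth None w (p - i)).
  exact: psum_shifted.
have wp : (size w <= p)%N by rewrite sw.
have sin : wordshift p j w \in dop_shifts (Ln R p j) by apply: wordshift_in_shifts.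
have d' := hden' sin w0.
rewrite /word_term.
rewrite (hahn_prod_word gam _ (coord (complete N y)) wp e); last first.
  by move=> k; apply: psum_nat_mono.
rewrite hahn_gamma_denE (gamma_den_word _ _ wp e); last 5 first.
- by move=> k; apply: psum_nat_mono.
- by move=> k; apply: psum_nat_mono.
- by rewrite sw; apply: regular_nodes.
- by rewrite -hahn_gamma_denE.
- by rewrite -hahn_gamma_denE.
rewrite -hahn_gamma_denE sw /common_factor.
by ring.
Qed.

Lemma nonneg_word w : w \in words j ->
  ~~ nonneg_index (shift_index n (wordshift p j w)) ->
  wprod (factorZ gam (psum n) Y) w p = 0.
Proof.
rewrite mem_words => /eqP sw; have [j0 jlep] := andP jp.
apply: contraNeq => f0; apply/nonneg_indexP => k kp.
rewrite coord_psum; last by case/andP: kp.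
rewrite !psum_shift_index !psum_wordshift ?sw //; try lia.
by apply: wprod_factorZ_neq0 f0 _ kp; [move=> i; apply: psum_nat_mono | rewrite sw].
Qed.

Lemma nonneg_nseq : nonneg_index (shift_index n (wordshift p j (nseq j None))).
Proof.
have [j0 jlep] := andP jp.
apply/nonneg_indexP => k kp; rewrite coord_psum; last by case/andP: kp.
rewrite !psum_shift_index !psum_wordshift ?size_nseq //; try lia.
rewrite !nth_nseq !if_same !addr0 subr_ge0.
by case: k kp => // k _; apply: psum_nat_mono.
Qed.

Lemma shifted_nseq : shifted (nseq j None) = n.
Proof.
have e k : (k <= p)%N -> psum (shifted (nseq j None)) k = psum n k.
  move=> kp; have := @psum_shifted (nseq j None) k (size_nseq _ _) nonneg_nseq kp.
  by rewrite nth_nseq if_same addr0 => -[].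
apply: rowP_coord => -[|k] // kp.
have := e k.+1 kp; rewrite !psumS e; last exact: ltnW.
exact: addnI.
Qed.

Lemma hahn_word : hahn n y gamma N
  = common_factor * wprod (factorZ gam (psum n) Y) (nseq j None) p.
Proof.
have [j0 jlep] := andP jp.
rewrite hahnE (@hahn_prod_word R gam (psum n) (psum n) _ (nseq j None)).
- by rewrite size_nseq /common_factor /prefactor invfM; ring.
- by move=> k; apply: psum_nat_mono.
- by rewrite size_nseq.
- by move=> i ip; rewrite nth_nseq if_same addr0.
Qed.

(** The limit is used exactly when the first letter is 1 and |n| = N; in all other cases
    (-N)_(|k|) is nonzero.  The zero word carries the omitted term nu = 0. *)
Lemma Lnt_term w : w \in words j ->
  nonneg_index (shift_index n (wordshift p j w)) ->
  (if (N \is a Num.nat) && ((psum (shifted w) p)%:R == N + 1) then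
    lim (Lnt_coeff j (wordshift p j w) n gamma M * hahn (shifted w) y gamma M @[M --> N^'])
   else Lnt_coeff j (wordshift p j w) n gamma N * hahn (shifted w) y gamma N)
  = word_term w - ev_start sv gv N None (p - j) * (w == nseq j None)%:R * hahn n y gamma N.
Proof.
move=> ww w0; have sw : size w = j by apply/eqP; rewrite -mem_words.
have := psum_shifted sw w0 (leqnn p); rewrite subnn -hd_nth => es.
case: ifPn => [/andP[natN /eqP eN]|cN].
  have leN := hn natN.
  have hw : hd w = Some true.
    case e : (hd w) => [[]|] //; exfalso; rewrite e /= in es.
      have : (psum (shifted w) p <= psum n p)%N by lia.
      by rewrite -(ler_nat R) eN; lra.
    have : (psum (shifted w) p <= psum n p)%N by lia.
    by rewrite -(ler_nat R) eN; lra.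
  have sN : (psum n p)%:R = N.
    rewrite hw /= in es; have : psum (shifted w) p = (psum n p).+1 by lia.
    by move=> e; move: eN; rewrite e -natr1 => /addIr.
  have wn : (w == nseq j None) = false.
    apply/eqP => e; move: hw; rewrite e.
    by case: (j) jp.
  rewrite wn mulr0 mul0r subr0 -(word_term_limit sw w0 hw sN).
  rewrite (_ : (fun M => Lnt_coeff _ _ _ _ _ * _)
    = (fun M => word_coeff M w * hahn (shifted w) y gamma M)) //.
  by apply: boolp.funext => M; rewrite Lnt_coeff_word // wn mulr0 subr0.
have pn' : poch (- N) (psum (shifted w) p) != 0.
  apply: poch_prefactor_neq0 => i ip; apply/eqP => eN; move: cN.
  have natN : N \is a Num.nat by rewrite eN natr_nat.
  have := hn natN; rewrite eN ler_nat => si.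
  rewrite natr_nat /= natr1 eqr_nat => /eqP; apply.
  have : (letter_val (hd w) <= 1)%R by case: (hd w) => [[]|].
  by lia.
rewrite Lnt_coeff_word // mulrBl word_term_direct //; congr (_ - _).
case: eqP => [->|_]; first by rewrite shifted_nseq.
by rewrite !mulr0 !mul0r.
Qed.

Lemma index_spectral :
  Lnt j gamma N (fun N' k => hahn k y gamma N') n = kappa j N y * hahn n y gamma N.
Proof.
have [j0 jlep] := andP jp.
pose f (kap : 'rV[int]_p) : R := let k := nat_index (shift_index n kap) in
  if (N \is a Num.nat) && ((psum k p)%:R == N + 1) then
    lim (Lnt_coeff j kap n gamma M * hahn k y gamma M @[M --> N^'])
  else Lnt_coeff j kap n gamma N * hahn k y gamma N.
transitivity (\sum_(kap <- dop_shifts (Ln R p j) | nonneg_index (shift_index n kap)) f kap).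
  by [].
rewrite (@sum_shifts R p j (fun s => nonneg_index (shift_index n s)) f jp); last first.
  move=> kap hk; have c0 M : Lnt_coeff j kap n gamma M = 0.
    rewrite Lnt_coeffE //; last exact: regular_nodes.
    rewrite big_seq big1 ?sub0r.
      by rewrite (negbTE (hk _ _)) ?mulr0 ?oppr0 // mem_words size_nseq.
    by move=> w /hk/negbTE ->; rewrite mulr0.
  rewrite /f; case: ifP => _; last by rewrite c0 mul0r.
  rewrite (_ : (fun M => _) = fun=> 0); first exact: lim_cst.
  by apply: boolp.funext => M; rewrite c0 mul0r.
rewrite big_seq_cond.
transitivity (\sum_(w <- words j) (common_factor * (psi gam (psum n) N (hd w) p
    * wprod (reduced gam (psum n)) w p * wprod (factorZ gam (psum n) Y) w p)
    - ev_start sv gv N None (p - j) * (w == nseq j None)%:R * hahn n y gamma N)).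
  rewrite -big_seq_cond big_mkcond !big_seq; apply: eq_bigr => w ww.
  case: ifPn => w0; first by rewrite /f Lnt_term // word_termE.
  rewrite nonneg_word // !mulr0 sub0r.
  case: eqP => [e|_]; last by rewrite mulr0 mul0r oppr0.
  by rewrite e nonneg_nseq in w0.
rewrite sumrB -mulr_sumr.
have := @word_sum R gam (psum n) Y (@psum_nat_mono p n) j p jlep regular_nodes.
rewrite [Y p.+1]psum_complete_last => ->.
rewrite (bigD1_seq (nseq j None)) ?uniq_words ?mem_words ?size_nseq //= eqxx.
rewrite big1 ?addr0; last by move=> w /negbTE ->; rewrite mulr0 mul0r.
rewrite /psi [Y _]psum_complete; last by lia.
rewrite mulrCA -hahn_word /kappa (_ : (p + 1 - j = (p - j).+1)%N); last by lia.
rewrite /ev_start; move: (hahn n y gamma N) (psum y _) (gv _) => a b c.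
rewrite [true%:R]mulr1n.
by field.
Qed.

End IndexSpectral.

Theorem theorem5p2 (R : realType) (p : nat) (hp : (1 <= p)%N)
    (gamma : 'rV[R]_p.+1) (N : R) (y : 'rV[R]_p) (n : 'rV[nat]_p)
    (hn : considered N n) (hden : hahn_gamma_den gamma n != 0)
    (j : nat) (hj : (1 <= j <= p)%N) :
  Ly j gamma N (fun z => hahn n z gamma N) y = mu j gamma n * hahn n y gamma N
  /\
  ((forall s : 'rV[int]_p, s \in dop_shifts (Ln R p j) ->
      nonneg_index (shift_index n s) ->
      hahn_gamma_den gamma (nat_index (shift_index n s)) != 0) ->
   Lnt_den_neq0 j gamma n ->
   Lnt j gamma N (fun N' k => hahn k y gamma N') n
   = kappa j N y * hahn n y gamma N).
Proof.
split; first by apply: argument_spectral; case/andP: hj.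
by move=> hden' hreg; apply: index_spectral.
Qed.
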